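(* Let $\Bbbk$ be a commutative ring, $H$ a Hopf algebra over $\Bbbk$, and $B$ a right $H$-comodule algebra. Then, for any finitely generated projective left $B$-module $M$ and any finitely generated left $H$-module $V$ that is finitely generated projective over $\Bbbk$, $$r_B(M\otimes V)=r_B(M)\cdot\chi_V\quad\text{in } T(B),$$ where $M\otimes V$ carries the diagonal $B$-action. Thus, as maps $K_0(B)\otimes_{\mathbb Z}G_0^\Bbbk(H)\to T(B)$, the composite of the module action $K_0(B)\otimes_{\mathbb Z}G_0^\Bbbk(H)\to K_0(B)$, $[M]\otimes[V]\mapsto[M\otimes V]$, followed by $r_B\colon K_0(B)\to T(B)$, equals the composite of $r_B\otimes\chi\colon K_0(B)\otimes_{\mathbb Z}G_0^\Bbbk(H)\to T(B)\otimes_{\mathbb Z}T(H)^*$ followed by the action map $T(B)\otimes_{\mathbb Z}T(H)^*\to T(B)$, $x\otimes f\mapsto x\cdot f$.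
   Context: $\otimes=\otimes_\Bbbk$, $(\cdot)^*=\operatorname{Hom}_\Bbbk(\cdot,\Bbbk)$; $\langle\,\cdot\,,\,\cdot\,\rangle\colon H^*\times H\to\Bbbk$ is evaluation. $H$ has comultiplication $\Delta$, counit $\varepsilon$, antipode $\mathcal S$. A right $H$-comodule algebra is a $\Bbbk$-algebra $B$ that is a right $H$-comodule via $\rho\colon B\to B\otimes H$, $b\mapsto\sum b_0\otimes b_1$, with $\rho(ab)=\sum a_0b_0\otimes a_1b_1$ and $\rho(1)=1\otimes1$. For a left $B$-module $M$ and a left $H$-module $V$, $M\otimes V$ is a left $B$-module with the diagonal action $b(m\otimes v)=\sum b_0m\otimes b_1v$. If $M$ is finitely generated projective over $B$ and $V$ is finitely generated projective over $\Bbbk$, then $M\otimes V$ is finitely generated projective over $B$. $K_0(B)$ is the Grothendieck group of finitely generated projective left $B$-modules. $G_0^\Bbbk(H)$ is the Grothendieck group (relations from short exact sequences) of finitely generated left $H$-modules that are finitely generated projective over $\Bbbk$; it is a ring under $[V][V']=[V\otimes V']$, with $H$ acting on $V\otimes V'$ via $\Delta$, and it acts on $K_0(B)$ from the right by $[M][V]=[M\otimes V]$. For a ring $R$, $[R,R]$ is the additive subgroup generated by all $xy-yx$, $T(R)=R/[R,R]$, and $T\colon R\to T(R)$ is the canonical map. The Hattori–Stallings rank of a finitely generated projective left $R$-module $P$ is $r_R(P)=\sum_iT(f_i(v_i))\in T(R)$, where $\{(f_i,v_i)\}\subseteq\operatorname{Hom}_R(P,R)\times P$ are dual bases for $P$ (i.e.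 $v=\sum_if_i(v)v_i$ for all $v\in P$); it is independent of the choice of dual bases and gives a homomorphism $r_R\colon K_0(R)\to T(R)$. $T(H)^*\subseteq H^*$ is the $\Bbbk$-module of trace forms on $H$, i.e. linear forms vanishing on $[H,H]$; it is a subalgebra of $H^*$ (with convolution product) stable under $\mathcal S^*$. The character $\chi_V\in T(H)^*$ of $V$ is $\chi_V(h)=$ trace over $\Bbbk$ of the action of $h$ on $V$; this gives a homomorphism $\chi\colon G_0^\Bbbk(H)\to T(H)^*$. $H^*$ acts on $B$ from the right by $b\cdot f=\sum b_0\langle f,\mathcal S(b_1)\rangle$. The submodule $[B,B]$ is stable under the action of $T(H)^*$, so $T(B)$ becomes a right $T(H)^*$-module: $T(b)\cdot f=\sum T(b_0)\langle f,\mathcal S(b_1)\rangle$. *)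

(* Defs.v *)
From HB Require Import structures.
From mathcomp Require Import all_boot all_order all_algebra.
From mathcomp Require Import boolp functions.
From mathcomp Require Import freeg.

Set Implicit Arguments.
Unset Strict Implicit.
Unset Printing Implicit Defensive.

Import GRing.Theory.
Local Open Scope ring_scope.
Local Open Scope quotient_scope.

Section Quotient.
Variables (R : nzRingType) (V : lmodType R) (S : V -> Prop).

Definition submod_span : {pred V} := fun v =>
  `[< exists2 s : seq (R * V), (forall ax, ax \in s -> S ax.2) &
        v = \sum_(ax <- s) ax.1 *: ax.2 >].

Lemma submod_span_closed : GRing.submod_closed submod_span.
Proof.
split; first by apply/asboolP; exists [::] => //; rewrite big_nil.
move=> c u v /asboolP[s sS ->] /asboolP[t tS ->]; apply/asboolP.
exists ([seq (c * ax.1, ax.2) | ax <- s] ++ t) => [ax|].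
  by rewrite mem_cat => /orP[/mapP[ax' /sS ? ->]|/tS].
rewrite big_cat big_map scaler_sumr; congr (_ + _).
by apply: eq_bigr => ax _; rewrite scalerA.
Qed.

HB.instance Definition _ :=
  GRing.isSubmodClosed.Build R V submod_span submod_span_closed.

Lemma submod_span_gen v : S v -> v \in submod_span.
Proof.
move=> Sv; apply/asboolP; exists [:: (1, v)]; last by rewrite big_seq1 scale1r.
by move=> ax; rewrite inE => /eqP->.
Qed.

Definition quotmod : Type := Quotient.quot submod_span.
HB.instance Definition _ := Choice.on quotmod.
HB.instance Definition _ := GRing.Zmodule.on quotmod.

Definition quotpi (v : V) : quotmod := \pi_(Quotient.quot submod_span) v.
Definition quotrepr (x : quotmod) : V := repr (x : Quotient.quot submod_span).

Lemma quotreprK : cancel quotrepr quotpi.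
Proof. by move=> x; rewrite /quotpi reprK. Qed.

Lemma quotpi_eq u v : (quotpi u == quotpi v) = (u - v \in submod_span).
Proof. by rewrite Quotient.idealrBE. Qed.

Lemma quotpiD : {morph quotpi : u v / u + v}.
Proof. exact: (raddfD (\pi_(Quotient.quot submod_span))). Qed.

Definition quotscale (a : R) (x : quotmod) : quotmod :=
  quotpi (a *: quotrepr x).

Lemma quotpiZ a v : quotpi (a *: v) = quotscale a (quotpi v).
Proof.
apply/eqP; rewrite quotpi_eq -scalerBr rpredZ//.
by rewrite -quotpi_eq quotreprK.
Qed.

Lemma quotscaleA a b x : quotscale a (quotscale b x) = quotscale (a * b) x.
Proof. by rewrite -(quotreprK x) -!quotpiZ scalerA. Qed.

Lemma quotscale1 : left_id 1 quotscale.
Proof. by move=> x; rewrite -(quotreprK x) -quotpiZ scale1r. Qed.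

Lemma quotscaleDr : right_distributive quotscale +%R.
Proof.
move=> a x y; rewrite -(quotreprK x) -(quotreprK y) -quotpiD -!quotpiZ.
by rewrite scalerDr quotpiD.
Qed.

Lemma quotscaleDl x : {morph quotscale^~ x : a b / a + b}.
Proof.
by move=> a b; rewrite -(quotreprK x) -!quotpiZ scalerDl quotpiD.
Qed.

HB.instance Definition _ := GRing.Zmodule_isLmodule.Build R quotmod
  quotscaleA quotscale1 quotscaleDr quotscaleDl.

Lemma quotpi_is_linear : linear quotpi.
Proof. by move=> a u v; rewrite quotpiD quotpiZ. Qed.

HB.instance Definition _ := GRing.isLinear.Build R V quotmod *:%R quotpi
  quotpi_is_linear.

(* g is evaluated at a representative, so this is the induced map only when *)
(* g is linear and kills S (quotliftE); preslift, tlift and groth_lift below *)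
(* inherit this proviso.                                                     *)
Definition quotlift (W : Type) (g : V -> W) (x : quotmod) : W :=
  g (quotrepr x).

Lemma quotliftE (W : lmodType R) (g : {linear V -> W}) v :
  (forall u, S u -> g u = 0) -> quotlift g (quotpi v) = g v.
Proof.
move=> gS; apply/eqP; rewrite -subr_eq0 /quotlift -linearB.
have : quotrepr (quotpi v) - v \in submod_span by rewrite -quotpi_eq quotreprK.
case/asboolP=> s sS ->; rewrite linear_sum big_seq big1// => ax /sS axS.
by rewrite linearZ_LR gS// scaler0.
Qed.
End Quotient.

Section Presented.
Variables (R : nzRingType) (X : choiceType) (S : {freeg X / R} -> Prop).

Definition presgen (x : X) : quotmod S := quotpi S << x >>.

Definition preslift (W : lmodType R) (f : X -> W) : quotmod S -> W :=
  quotlift (fglift f).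

Lemma fglift_is_linear (W : lmodType R) (f : X -> W) : linear (fglift f).
Proof.
pose F := fglift f.
pose Fm := GRing.isAdditive.Build {freeg X / R} W F (lift_is_additive f).
pose Fa : {additive {freeg X / R} -> W} := HB.pack F Fm.
have F0 : F 0 = 0 by exact: (raddf0 Fa).
have FD : {morph F : D E / D + E} by exact: (raddfD Fa).
have FZ a D : F (a *: D) = a *: F D.
  elim/freeg_ind_dom0: D => [|b x D _ _ IH]; first by rewrite scaler0 F0 scaler0.
  rewrite scalerDr !FD IH scalerDr; congr (_ + _).
  have -> : a *: << b *g x >> = << (a * b) *g x >>.
    by apply/eqP/freeg_eqP=> y; rewrite coeffZ !coeffU mulrA.
  by rewrite /F !liftU scalerA.
by move=> a D E; rewrite -/F FD FZ.
Qed.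

Lemma preslift_linear (W : lmodType R) (f : X -> W) :
    (forall D, S D -> fglift f D = 0) ->
  linear (preslift f) /\ forall x, preslift f (presgen x) = f x.
Proof.
move=> fS.
pose Fm := GRing.isLinear.Build R {freeg X / R} W _ (fglift f) (fglift_is_linear f).
pose F : {linear {freeg X / R} -> W} := HB.pack (fglift f) Fm.
have FE D : preslift f (quotpi S D) = F D by exact: (@quotliftE _ _ S W F D fS).
split=> [a x y|x]; last by rewrite /presgen FE /= liftU scale1r.
by rewrite -(quotreprK x) -(quotreprK y) -linearP !FE linearP.
Qed.
End Presented.

Section Tensor.
Variables (k : comNzRingType) (M N : lmodType k).

Inductive bilinear_rel : {freeg (M * N) / k} -> Prop :=
| BilinearRelL c m m' n : bilinear_rel
    (<< (c *: m + m', n) >> - (c *: << (m, n) >> + << (m', n) >>))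
| BilinearRelR c m n n' : bilinear_rel
    (<< (m, c *: n + n') >> - (c *: << (m, n) >> + << (m, n') >>)).

Definition tensor : Type := quotmod bilinear_rel.
HB.instance Definition _ := GRing.Lmodule.on tensor.

Definition tens (m : M) (n : N) : tensor := presgen bilinear_rel (m, n).

Definition tlift (P : lmodType k) (f : M -> N -> P) : tensor -> P :=
  preslift (fun mn => f mn.1 mn.2).

Definition bilinear_map (P : lmodType k) (f : M -> N -> P) :=
  (forall n, linear (f^~ n)) /\ (forall m, linear (f m)).

Lemma tlift_linear (P : lmodType k) (f : M -> N -> P) : bilinear_map f ->
  linear (tlift f) /\ forall m n, tlift f (tens m n) = f m n.
Proof.
move=> [fl fr]; case: (@preslift_linear k (M * N)%type bilinear_rel P
  (fun mn => f mn.1 mn.2)) => [D|lin gen]; last first.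
  by split=> // m n; apply: gen.
pose Fm := GRing.isLinear.Build k {freeg (M * N) / k} P _ _
  (fglift_is_linear (fun mn : M * N => f mn.1 mn.2)).
pose F : {linear {freeg (M * N) / k} -> P} := HB.pack (fglift _) Fm.
rewrite -[fglift _]/(F : _ -> _).
have FU x : F << x >> = f x.1 x.2 by rewrite /F /= liftU scale1r.
by case=> [c m m' n|c m n n'];
  rewrite linearB linearP !FU /= ?fl ?fr subrr.
Qed.

Lemma tens_bilinear : bilinear_map tens.
Proof.
split=> [n c m m'|m c n n']; apply/eqP; rewrite -linearP quotpi_eq;
  apply: submod_span_gen; by [apply: BilinearRelL | apply: BilinearRelR].
Qed.

Lemma tensDl m m' n : tens (m + m') n = tens m n + tens m' n.
Proof. by have := tens_bilinear.1 n 1 m m'; rewrite !scale1r. Qed.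

Lemma tensDr m n n' : tens m (n + n') = tens m n + tens m n'.
Proof. by have := tens_bilinear.2 m 1 n n'; rewrite !scale1r. Qed.

Lemma tens0l n : tens 0 n = 0.
Proof. by apply: (addrI (tens 0 n)); rewrite -tensDl !addr0. Qed.

Lemma tens0r m : tens m 0 = 0.
Proof. by apply: (addrI (tens m 0)); rewrite -tensDr !addr0. Qed.

Lemma tensZl c m n : tens (c *: m) n = c *: tens m n.
Proof. by have := tens_bilinear.1 n c m 0; rewrite !addr0 tens0l addr0. Qed.

Lemma tensZr c m n : tens m (c *: n) = c *: tens m n.
Proof. by have := tens_bilinear.2 m c n 0; rewrite !addr0 tens0r addr0. Qed.

Lemma tensor_ind (P : tensor -> Prop) :
    P 0 -> (forall m n t, P t -> P (tens m n + t)) ->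
  forall t, P t.
Proof.
move=> P0 PD t; rewrite -(quotreprK t).
elim/freeg_ind_dom0: (quotrepr t) => [|c [m n] D _ _]; first by rewrite linear0.
rewrite linearD => /(PD (c *: m) n); congr (P (_ + _)).
rewrite tensZl /tens /presgen -linearZ_LR; congr quotpi.
by apply/eqP/freeg_eqP=> y; rewrite coeffZ !coeffU mulrA mulr1.
Qed.
End Tensor.

Definition tmap (k : comNzRingType) (M N M' N' : lmodType k)
    (f : M -> M') (g : N -> N') : tensor M N -> tensor M' N' :=
  tlift (fun m n => tens (f m) (g n)).

Definition tassoc (k : comNzRingType) (M N P : lmodType k) :
    tensor (tensor M N) P -> tensor M (tensor N P) :=
  tlift (fun t p => tlift (fun m n => tens m (tens n p)) t).

(* (a (x) b) (a' (x) b') = aa' (x) bb', the product of the algebra A (x) B. *)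
Definition tmul (k : comNzRingType) (A B : algType k)
    (s t : tensor A B) : tensor A B :=
  tlift (fun a b => tlift (fun a' b' => tens (a * a') (b * b')) t) s.

HB.mixin Record isHopfAlgebra (k : comNzRingType) H of GRing.Algebra k H := {
  comul : {linear H -> tensor H H};
  counit : {lrmorphism H -> k^o};
  antipode : {linear H -> H};
  comulA : forall h,
    tassoc (tmap comul idfun (comul h)) = tmap idfun comul (comul h);
  comulL : forall h, tlift (fun a b => counit a *: b) (comul h) = h;
  comulR : forall h, tlift (fun a b => counit b *: a) (comul h) = h;
  comul1 : comul 1 = tens 1 1;
  comulM : forall g h, comul (g * h) = tmul (comul g) (comul h);
  antipodeL : forall h,
    tlift (fun a b => antipode a * b) (comul h) = (counit h)%:A;
  antipodeR : forall h,
    tlift (fun a b => a * antipode b) (comul h) = (counit h)%:A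
}.

#[short(type="hopfAlgType")]
HB.structure Definition HopfAlgebra (k : comNzRingType) :=
  {H of isHopfAlgebra k H & GRing.Algebra k H}.

HB.mixin Record isComoduleAlgebra (k : comNzRingType) (H : hopfAlgType k) B
    of GRing.Algebra k B := {
  coact : {linear B -> tensor B H};
  coactA : forall b,
    tassoc (tmap coact idfun (coact b)) = tmap idfun (@comul k H) (coact b);
  coactR : forall b, tlift (fun b0 b1 => (counit b1 : k) *: b0) (coact b) = b;
  coact1 : coact 1 = tens 1 1;
  coactM : forall a b, coact (a * b) = tmul (coact a) (coact b)
}.

#[short(type="comodAlgType")]
HB.structure Definition ComoduleAlgebra (k : comNzRingType) (H : hopfAlgType k) :=
  {B of isComoduleAlgebra k H B & GRing.Algebra k B}.

Lemma algZl (k : comNzRingType) (A : algType k) (W : lmodType A)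
  (a : A) (c : k) (w : W) : (c *: a) *: w = c%:A *: (a *: w).
Proof. by rewrite scalerA -scalerAl mul1r. Qed.

Lemma algZC (k : comNzRingType) (A : algType k) (W : lmodType A)
  (a : A) (c : k) (w : W) : a *: (c%:A *: w) = c%:A *: (a *: w).
Proof. by rewrite !scalerA -scalerAr -scalerAl mulr1 mul1r. Qed.

Section Restriction.
Variables (k : comNzRingType) (A : algType k) (M : lmodType A).

(* M viewed as a k-module; the alias keeps the k- and A-module structures    *)
(* apart.                                                                    *)
Definition restr : Type := M.
HB.instance Definition _ := GRing.Zmodule.on restr.

Definition restr_scale (c : k) (m : restr) : restr := c%:A *: (m : M).

Lemma restr_scaleA a b m : restr_scale a (restr_scale b m) = restr_scale (a * b) m.
Proof. by rewrite /restr_scale scalerA -scalerAl mul1r scalerA. Qed.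

Lemma restr_scale1 : left_id 1 restr_scale.
Proof. by move=> m; rewrite /restr_scale !scale1r. Qed.

Lemma restr_scaleDr : right_distributive restr_scale +%R.
Proof. by move=> a m n; rewrite /restr_scale scalerDr. Qed.

Lemma restr_scaleDl m : {morph restr_scale^~ m : a b / a + b}.
Proof. by move=> a b; rewrite /restr_scale !scalerDl. Qed.

HB.instance Definition _ := GRing.Zmodule_isLmodule.Build k restr
  restr_scaleA restr_scale1 restr_scaleDr restr_scaleDl.

Lemma restr_scaleE (c : k) (m : restr) : c *: m = c%:A *: (m : M) :> M.
Proof. by []. Qed.
End Restriction.

Section Diagonal.
Variables (k : comNzRingType) (H : hopfAlgType k) (B : comodAlgType H).
Variables (M : lmodType B) (V : lmodType H).

(* Alias of M (x)_k V that carries the B-module structure.                    *)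
Definition diag_tensor : Type := tensor (restr M) (restr V).
HB.instance Definition _ := GRing.Zmodule.on diag_tensor.

Definition diag_tens (m : M) (v : V) : diag_tensor :=
  tens (m : restr M) (v : restr V).

Definition diag_op (b : B) (h : H) : diag_tensor -> diag_tensor :=
  @tmap k (restr M) (restr V) (restr M) (restr V)
    (fun m => b *: (m : M)) (fun v => h *: (v : V)).

(* x t = sum b m (x) h v for x = sum b (x) h and t = sum m (x) v; then       *)
(* b t is taken to be rho(b) t.                                              *)
Definition diag_opt (x : tensor B H) (t : diag_tensor) : diag_tensor :=
  @tlift k B H (tensor (restr M) (restr V)) (fun b h => diag_op b h t) x.

Definition diag_scale (b : B) (t : diag_tensor) : diag_tensor :=
  diag_opt (@coact k H B b) t.

Let diag_opP b h :
  linear (diag_op b h : tensor (restr M) (restr V) -> tensor (restr M) (restr V))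
  /\ forall m v, diag_op b h (diag_tens m v) = diag_tens (b *: m) (h *: v).
Proof.
apply: tlift_linear; split=> [v c m m'|m c v v'].
  by rewrite -tensZl -tensDl scalerDr algZC.
by rewrite -tensZr -tensDr scalerDr algZC.
Qed.

Let diag_opD b h : {morph diag_op b h : s t / s + t}.
Proof. by move=> s t; have := (diag_opP b h).1 1 s t; rewrite !scale1r. Qed.

Let diag_op0 b h : diag_op b h 0 = 0.
Proof. by apply: (addrI (diag_op b h 0)); rewrite -diag_opD !addr0. Qed.

Let diag_op_bilinear t : @bilinear_map k B H (tensor (restr M) (restr V))
  (fun b h => diag_op b h t).
Proof.
elim/tensor_ind: t => [|m v t [IHl IHr]].
  by split=> [h c b b'|b c h h']; rewrite !diag_op0 scaler0 addr0.
split=> [h c b b'|b c h h']; rewrite !diag_opD ?(IHl, IHr) !(diag_opP _ _).2.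
  rewrite scalerDr addrACA; congr (_ + _); rewrite -tensZl -tensDl.
  by rewrite scalerDl algZl.
rewrite scalerDr addrACA; congr (_ + _); rewrite -tensZr -tensDr.
by rewrite scalerDl algZl.
Qed.

Let diag_optP t :
  linear (diag_opt^~ t : tensor B H -> tensor (restr M) (restr V)) /\
  forall b h, diag_opt (tens b h) t = diag_op b h t.
Proof. exact: tlift_linear (diag_op_bilinear t). Qed.

Let diag_optDl t : {morph diag_opt^~ t : x y / x + y}.
Proof. by move=> x y; have := (diag_optP t).1 1 x y; rewrite !scale1r. Qed.

Let diag_opt0l t : diag_opt 0 t = 0.
Proof. by apply: (addrI (diag_opt 0 t)); rewrite -diag_optDl !addr0. Qed.

Let diag_optDr x : {morph diag_opt x : s t / s + t}.
Proof.
move=> s t; elim/tensor_ind: x => [|b h x IH]; first by rewrite !diag_opt0l addr0.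
by rewrite !diag_optDl !(diag_optP _).2 IH diag_opD addrACA.
Qed.

Let tmul_bilinear b h :
  @bilinear_map k B H (tensor B H) (fun b' h' => tens (b * b') (h * h')).
Proof.
split=> [n c x y|n c x y].
  by rewrite mulrDr tensDl -scalerAr tensZl.
by rewrite mulrDr tensDr -scalerAr tensZr.
Qed.

Let diag_opt_mul x y t : diag_opt (tmul x y) t = diag_opt x (diag_opt y t).
Proof.
pose L b h := tlift (fun b' h' => tens (b * b') (h * h')) : tensor B H -> tensor B H.
have [LL LE] : (forall b h, linear (L b h)) /\
    forall b h b' h', L b h (tens b' h') = tens (b * b') (h * h').
  by split=> b h; have [] := tlift_linear (tmul_bilinear b h).
have LD b h : {morph L b h : u v / u + v}.
  by move=> u v; have := LL b h 1 u v; rewrite !scale1r.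
have L0 b h : L b h 0 = 0.
  by apply: (addrI (L b h 0)); rewrite -LD !addr0.
have Lbil u : @bilinear_map k B H (tensor B H) (fun b h => L b h u).
  elim/tensor_ind: u => [|b' h' u [IHl IHr]].
    by split=> [h c b b'|b c h h']; rewrite !L0 scaler0 addr0.
  split=> [h c b b''|b c h h'']; rewrite !LD ?(IHl, IHr) !LE.
    by rewrite scalerDr addrACA mulrDl tensDl -scalerAl tensZl.
  by rewrite scalerDr addrACA mulrDl tensDr -scalerAl tensZr.
have [ML ME] := tlift_linear (Lbil y).
have MD : {morph (fun x => tmul x y) : u v / u + v}.
  by move=> u v; have := ML 1 u v; rewrite !scale1r.
have M0 : tmul 0 y = 0 by apply: (addrI (tmul 0 y)); rewrite -MD !addr0.
elim/tensor_ind: x => [|b h x IH]; first by rewrite M0 !diag_opt0l.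
rewrite MD !diag_optDl IH (diag_optP _).2; congr (_ + _).
rewrite [tmul _ _]ME; elim/tensor_ind: (y) => [|b' h' u IHu].
  by rewrite L0 !diag_opt0l diag_op0.
rewrite LD LE !diag_optDl IHu diag_opD !(diag_optP _).2; congr (_ + _).
elim/tensor_ind: t {Lbil ML ME MD M0 IH IHu} => [|m v t IHt].
  by rewrite !diag_op0.
by rewrite !diag_opD IHt !(diag_opP _ _).2 !scalerA.
Qed.

Lemma diag_scaleA a b t : diag_scale a (diag_scale b t) = diag_scale (a * b) t.
Proof. by rewrite /diag_scale coactM diag_opt_mul. Qed.

Lemma diag_scale1 : left_id 1 diag_scale.
Proof.
move=> t; rewrite /diag_scale coact1 (diag_optP _).2.
elim/tensor_ind: t => [|m v t IH]; first by rewrite diag_op0.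
by rewrite diag_opD IH (diag_opP _ _).2 !scale1r.
Qed.

Lemma diag_scaleDr : right_distributive diag_scale +%R.
Proof. by move=> a s t; apply: diag_optDr. Qed.

Lemma diag_scaleDl t : {morph diag_scale^~ t : a b / a + b}.
Proof. by move=> a b; rewrite /diag_scale linearD diag_optDl. Qed.

HB.instance Definition _ := GRing.Zmodule_isLmodule.Build B diag_tensor
  diag_scaleA diag_scale1 diag_scaleDr diag_scaleDl.

End Diagonal.

Section Modules.
Variables (R : nzRingType) (P : lmodType R).

Definition fin_gen : Prop :=
  exists n (x : 'I_n -> P), forall v, exists c : 'I_n -> R,
    v = \sum_i c i *: x i.

Definition projective : Prop :=
  forall (X Y : lmodType R) (p : {linear X -> Y}) (f : {linear P -> Y}),
    (forall y, exists x, p x = y) -> exists g : {linear P -> X}, p \o g =1 f.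

Definition fgproj : Prop := fin_gen /\ projective.

Definition dual_bases (s : seq ({linear P -> R^o} * P)) : Prop :=
  forall v, v = \sum_(fx <- s) fx.1 v *: fx.2.

(* Dual bases exist iff P is finitely generated projective; otherwise the    *)
(* empty list is a dummy value. Independence of the choice: hsrankE and      *)
(* mod_traceE.                                                               *)
Definition some_dual_bases : seq ({linear P -> R^o} * P) :=
  if pselect (exists s, dual_bases s) is left sP then projT1 (cid sP)
  else [::].
End Modules.

(* T(R) = R / [R, R]; additive subgroups are the submodules over int.       *)
Definition commutators (R : nzRingType) : zmodule R -> Prop :=
  fun z => exists x y : R, z = x * y - y * x.
Definition hstrace (R : nzRingType) : Type := quotmod (@commutators R).
HB.instance Definition _ (R : nzRingType) := GRing.Lmodule.on (hstrace R).
Definition tr (R : nzRingType) (x : R) : hstrace R :=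
  quotpi (@commutators R) x.

Definition hsrank (R : nzRingType) (P : lmodType R) : hstrace R :=
  \sum_(fx <- some_dual_bases P) tr (fx.1 fx.2).

Section RankIndependence.
Variables (R : nzRingType) (P : lmodType R).

Lemma tr0 : tr 0 = 0 :> hstrace R. Proof. exact: (linear0 (quotpi (@commutators R))). Qed.

Lemma trD : {morph @tr R : x y / x + y}. Proof. exact: (linearD (quotpi (@commutators R))). Qed.

Lemma trC (x y : R) : tr (x * y) = tr (y * x).
Proof.
apply/eqP; rewrite quotpi_eq; apply: submod_span_gen.
by exists x, y.
Qed.

Lemma hsrankE (s : seq ({linear P -> R^o} * P)) : dual_bases s ->
  hsrank P = \sum_(fx <- s) tr (fx.1 fx.2).
Proof.
move=> sP; rewrite /hsrank /some_dual_bases; case: pselect => [ex|[]]; last by exists s.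
case: cid => /= t tP.
have key (f : {linear P -> R^o}) x r : dual_bases r ->
    tr (f x) = \sum_(gy <- r) tr (gy.1 x * f gy.2) :> hstrace R.
  move=> rP; rewrite {1}(rP x) linear_sum.
  transitivity (tr (\sum_(gy <- r) gy.1 x * f gy.2 : R)).
    by congr tr; apply: eq_bigr => gy _; rewrite linearZ.
  exact: (linear_sum (quotpi (@commutators R))).
under eq_bigr => fx _ do rewrite (key _ _ _ sP).
under [RHS]eq_bigr => gy _ do rewrite (key _ _ _ tP).
rewrite exchange_big; apply: eq_bigr => gy _; apply: eq_bigr => fx _ /=.
exact: trC.
Qed.
End RankIndependence.

Section TraceForms.
Variables (k : comNzRingType) (H : algType k).

Definition trace_form : {pred (H -> k^o)} := fun f =>
  `[< linear f /\ forall x y, f (x * y) = f (y * x) >].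

Lemma trace_form_closed : GRing.submod_closed trace_form.
Proof.
split=> [|a f g /asboolP[fl ft] /asboolP[gl gt]]; apply/asboolP.
  by split=> // c x y; rewrite /GRing.zero /= scaler0 addr0.
split=> [c x y|x y] /=.
  by rewrite !fctE fl gl !scalerDr addrACA !scalerA [a * c]mulrC.
by rewrite !fctE ft gt.
Qed.

HB.instance Definition _ :=
  GRing.isSubmodClosed.Build k (H -> k^o) trace_form trace_form_closed.

Record trform : Type :=
  TraceForm { trform_val :> H -> k^o; _ : trace_form trform_val }.
HB.instance Definition _ := [isSub for trform_val].
HB.instance Definition _ := [Choice of trform by <:].
HB.instance Definition _ := [SubChoice_isSubLmodule of trform by <:].
End TraceForms.

(* The trace of an endomorphism u of a finitely generated projective module *)
(* over k is sum_i f_i (u v_i) for dual bases (f_i, v_i).                   *)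
Section Trace.
Variables (k : comNzRingType) (W : lmodType k).

Definition mod_trace (u : W -> W) : k :=
  \sum_(fx <- some_dual_bases W) fx.1 (u fx.2).

Lemma dual_trace s t (u w : {linear W -> W}) : dual_bases s -> dual_bases t ->
  \sum_(fx <- s) fx.1 (u (w fx.2)) = \sum_(gy <- t) gy.1 (w (u gy.2)) :> k.
Proof.
move=> sP tP.
have key (f : {linear W -> k^o}) (a : {linear W -> W}) x r : dual_bases r ->
    f (a x) = \sum_(gy <- r) gy.1 x * f (a gy.2) :> k.
  move=> rP; rewrite {1}(rP x) linear_sum linear_sum.
  by apply: eq_bigr => gy _; rewrite linearZ_LR linearZ_LR.
under eq_bigr => fx _ do rewrite (key _ _ _ _ tP).
under [RHS]eq_bigr => gy _ do rewrite (key _ _ _ _ sP).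
rewrite exchange_big; apply: eq_bigr => gy _; apply: eq_bigr => fx _ /=.
exact: mulrC.
Qed.

Lemma mod_traceE s (u : {linear W -> W}) : dual_bases s ->
  mod_trace u = \sum_(fx <- s) fx.1 (u fx.2).
Proof.
move=> sP; rewrite /mod_trace /some_dual_bases.
case: pselect => [ex|[]]; last by exists s.
by case: cid => /= t tP; apply: (@dual_trace t s u idfun).
Qed.

Lemma mod_traceC (u w : {linear W -> W}) :
  mod_trace (u \o w) = mod_trace (w \o u).
Proof.
rewrite /mod_trace /some_dual_bases; case: pselect => [ex|_]; last by rewrite !big_nil.
by case: cid => /= t tP; apply: dual_trace.
Qed.

Lemma mod_trace_linear c (u w : W -> W) :
  mod_trace (fun x => c *: u x + w x) = c * mod_trace u + mod_trace w.
Proof.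
rewrite /mod_trace mulr_sumr -big_split; apply: eq_bigr => fx _ /=.
by rewrite linearP.
Qed.
End Trace.

Section Characters.
Variables (k : comNzRingType) (H : algType k) (V : lmodType H).

Definition hact (h : H) (v : restr V) : restr V := h *: (v : V).

Lemma hact_linear h : linear (hact h).
Proof.
by move=> c v w; rewrite /hact scalerDr algZC.
Qed.
HB.instance Definition _ h :=
  GRing.isLinear.Build k (restr V) (restr V) *:%R (hact h) (hact_linear h).

Definition character_fun (h : H) : k^o := mod_trace (hact h).

Lemma character_funP : trace_form character_fun.
Proof.
apply/asboolP; split=> [c g h|g h].
  apply: etrans (mod_trace_linear c (hact g) (hact h)); congr mod_trace.
  apply/funext => v; rewrite /hact scalerDl; congr (_ + _).
  exact: algZl.
have hactM x y : hact (x * y) = hact x \o hact y.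
  by apply/funext => v; rewrite /hact /= scalerA.
by rewrite /character_fun !hactM mod_traceC.
Qed.

Definition character : trform H := TraceForm character_funP.
End Characters.

(* T(b).f = T(sum b0 <f, S b1>); a quotlift, well defined because [B, B] is  *)
(* stable under trace forms.                                                 *)
Definition tr_act (k : comNzRingType) (H : hopfAlgType k) (B : comodAlgType H)
    (x : hstrace B) (f : trform H) : hstrace B :=
  quotlift (fun b : zmodule B =>
    tr (tlift (fun b0 b1 => f (antipode b1) *: b0) (@coact k H B b))) x.

(* All R-modules form a proper class relative to the universe of lmodType R, *)
(* so the generators of the Grothendieck group are taken among the modules   *)
(* R^n / <rel>; every finitely generated module is isomorphic to one of them. *)
Record modpres (R : nzRingType) := ModPres {
  modpres_size : nat;
  modpres_rel : 'rV[R]_modpres_size -> Prop }.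
HB.instance Definition _ (R : nzRingType) := gen_eqMixin (modpres R).
HB.instance Definition _ (R : nzRingType) := gen_choiceMixin (modpres R).

Section Grothendieck.
Variables (R : nzRingType) (C : lmodType R -> Prop).

Definition pmod (c : modpres R) : Type := quotmod (@modpres_rel R c).
HB.instance Definition _ c := GRing.Lmodule.on (pmod c).

Definition groth_gen : Type := {c : modpres R | `[< C (pmod c) >]}.
HB.instance Definition _ := Choice.on groth_gen.
Definition groth_mod (c : groth_gen) : lmodType R := pmod (val c).

Inductive ses_rel : {freeg groth_gen / int} -> Prop :=
| SesRel c1 c2 c3 (i : {linear groth_mod c1 -> groth_mod c2})
      (p : {linear groth_mod c2 -> groth_mod c3}) :
    injective i -> (forall z, exists y, p y = z) ->
    (forall y, p y = 0 <-> exists x, i x = y) ->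
  ses_rel (<< c2 >> - (<< c1 >> + << c3 >>)).

Definition groth : Type := quotmod ses_rel.
HB.instance Definition _ := GRing.Lmodule.on groth.

(* The class of any M isomorphic to a generator, in particular of any M in C *)
(* when C consists of finitely generated modules and is stable under         *)
(* isomorphism; two such generators are identified by ses_rel. The value 0   *)
(* is a dummy.                                                               *)
Definition groth_class (M : lmodType R) : groth :=
  if pselect (exists c : groth_gen,
      exists f : {linear groth_mod c -> M}, bijective f) is left cM
  then presgen ses_rel (projT1 (cid cM)) else 0.

Definition groth_lift (A : lmodType int) (f : lmodType R -> A) : groth -> A :=
  preslift (fun c => f (groth_mod c)).

Lemma groth_lift_linear (A : lmodType int) (f : lmodType R -> A) :
    (forall (M1 M2 M3 : lmodType R) (i : {linear M1 -> M2})
        (p : {linear M2 -> M3}), C M1 -> C M2 -> C M3 ->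
      injective i -> (forall z, exists y, p y = z) ->
      (forall y, p y = 0 <-> exists x, i x = y) -> f M2 = f M1 + f M3) ->
  linear (groth_lift f) /\
  forall c, groth_lift f (presgen ses_rel c) = f (groth_mod c).
Proof.
move=> fS; apply: preslift_linear => _ [c1 c2 c3 i p iI pS ip].
pose Fm := GRing.isLinear.Build int {freeg groth_gen / int} A _ _
  (fglift_is_linear (fun c => f (groth_mod c))).
pose F : {linear {freeg groth_gen / int} -> A} := HB.pack (fglift _) Fm.
rewrite -[fglift _]/(F : _ -> _).
have FU c : F << c >> = f (groth_mod c) by rewrite /F /= liftU scale1r.
have Cc (c : groth_gen) : C (groth_mod c) by case: c => c cC; apply/asboolP.
by rewrite linearB linearD !FU (fS _ _ _ i p) ?subrr.
Qed.
End Grothendieck.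

(* Short exact sequences of projective modules split, so these relations are *)
(* the direct-sum ones.                                                      *)
Definition K0 (R : nzRingType) : Type := groth (@fgproj R).
HB.instance Definition _ (R : nzRingType) := GRing.Lmodule.on (K0 R).

Definition G0 (k : comNzRingType) (H : algType k) : Type :=
  groth (fun V : lmodType H => fin_gen V /\ fgproj (restr V)).
HB.instance Definition _ (k : comNzRingType) (H : algType k) :=
  GRing.Lmodule.on (G0 H).

Definition K0_class (R : nzRingType) (M : lmodType R) : K0 R := groth_class _ M.
Definition K0_rank (R : nzRingType) : K0 R -> hstrace R :=
  groth_lift (@hsrank R).

Definition G0_char (k : comNzRingType) (H : algType k) : G0 H -> zmodule (trform H) :=
  groth_lift (fun V => character V : zmodule (trform H)).

Section Action.
Variables (k : comNzRingType) (H : hopfAlgType k) (B : comodAlgType H).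

(* [M] (x) [V] |-> [M (x) V]                                                  *)
Definition K0_act : tensor (K0 B) (G0 H) -> K0 B :=
  tlift (fun x y => groth_lift (fun M =>
    groth_lift (fun V => K0_class (diag_tensor M V)) y) x).

(* x (x) f |-> x.f on T(B) (x)_Z T(H)^*                                        *)
Definition tr_act_map : tensor (hstrace B) (zmodule (trform H)) -> hstrace B :=
  tlift (fun (x : hstrace B) (f : zmodule (trform H)) => tr_act x f).
End Action.

(* Main.v *)
Require Import Defs.
From HB Require Import structures.
From mathcomp Require Import all_boot all_order all_algebra.
From mathcomp Require Import boolp functions.
From mathcomp Require Import freeg.

(** The proof computes with explicit dual bases. Write rho(b) = b0 (x) b1 and
    S for the antipode. If (f_i, m_i) are dual bases of M over B and
    (g_j, v_j) are dual bases of V over k, then the elements m_i (x) v_j and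
    the forms
      F_ij(m (x) v) = sum a0 g_j(S(a1) v),   where a = f_i(m),
    are dual bases of the diagonal B-module M (x) V. These forms come from the
    untwisting isomorphism b (x) v |-> b0 (x) b1 v from B (x) V, with B acting
    on the left factor only, to B (x) V with the diagonal action: its inverse
    is b (x) v |-> b0 (x) S(b1) v. Evaluating F_ij at m_i (x) v_j and summing
    over j turns g_j(S(a1) v_j) into chi_V(S(a1)) with a = f_i(m_i), so the
    rank of M (x) V is the sum of the T(a0) chi_V(S(a1)), which is
    r_B(M).chi_V (hsrank_diag_tensor). Along the way S(xy) = S(y) S(x)
    (antipodeM) gives both the B-linearity of F_ij (diag_formZ) and the
    stability of [B, B] under trace forms (tr_antipode_actC), without which
    the action on T(B) would depend on representatives.

    The identity of maps on K_0(B) (x) G_0(H) follows by comparing generators,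
    once every map involved is known to be additive. Short exact sequences of
    finitely generated projective B-modules split over B, and those of
    H-modules that are projective over k split over k. A splitting provides
    dual bases of the middle term, hence additivity of the rank and of the
    character, and it survives tensoring over k, hence additivity of
    [M (x) V] in M and in V (K0_class_diagl, K0_class_diagr). *)

Set Implicit Arguments.
Unset Strict Implicit.
Unset Printing Implicit Defensive.

Import GRing.Theory.
Local Open Scope ring_scope.

(** * Linear maps given as plain functions *)

(** The maps of this theory are plain functions that come with a proof of
    linearity; packing them gives access to the lemmas on bundled maps. *)
Definition lin_of (R : nzRingType) (M N : lmodType R) (f : M -> N)
    (fl : linear f) : {linear M -> N} :=
  HB.pack f (GRing.isLinear.Build R M N *:%R f fl).

Lemma linfun_sum (R : nzRingType) (M N : lmodType R) (f : M -> N) (I : Type)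
    (s : seq I) (F : I -> M) : linear f ->
  f (\sum_(i <- s) F i) = \sum_(i <- s) f (F i).
Proof. by move=> fl; apply: (linear_sum (lin_of fl)). Qed.

Lemma linfunZ (R : nzRingType) (M N : lmodType R) (f : M -> N) (c : R) (x : M) :
  linear f -> f (c *: x) = c *: f x.
Proof. by move=> fl; apply: (linearZ_LR (lin_of fl)). Qed.

Lemma comp_linear (R : nzRingType) (M N P : lmodType R) (f : M -> N) (g : N -> P) :
  linear f -> linear g -> linear (g \o f).
Proof. by move=> fl gl c x y /=; rewrite fl gl. Qed.

Lemma additive_linear (M N : lmodType int) (f : M -> N) :
  {morph f : x y / x + y} -> linear f.
Proof.
move=> fD; have f0 : f 0 = 0 by apply: (addrI (f 0)); rewrite -fD !addr0.
have fN x : f (- x) = - f x.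
  by apply: (addrI (f x)); rewrite -fD !subrr.
have fMn x n : f (x *+ n) = f x *+ n.
  by elim: n => [|n IH]; rewrite ?mulr0n// !mulrS fD IH.
have scE (L : lmodType int) (n : int) (x : L) : n *: x = x *~ n.
  by rewrite -scaler_int intz.
move=> n x y; rewrite fD !scE; congr (_ + _).
by case: n => n; rewrite ?NegzE ?mulrNz ?fN -!pmulrn fMn.
Qed.

(** * Sweedler sums *)

Section Sweedler.
Variable k : comNzRingType.

Section Decomposition.
Variables M N P : lmodType k.

Lemma tensor_decomp (t : tensor M N) :
  exists s : seq (M * N), t = \sum_(p <- s) tens p.1 p.2.
Proof.
elim/tensor_ind: t => [|m n t [s ->]]; first by exists [::]; rewrite big_nil.
by exists ((m, n) :: s); rewrite big_cons.
Qed.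

(** The pairs (t0, t1) of Sweedler notation: an arbitrary decomposition of t,
    fixed by choice. Only expressions bilinear in (t0, t1) are summed over it,
    and these do not depend on the choice (tlift_sum). *)
Definition tdecomp (t : tensor M N) : seq (M * N) := sval (cid (tensor_decomp t)).

Lemma tdecompE t : t = \sum_(p <- tdecomp t) tens p.1 p.2.
Proof. by rewrite /tdecomp; case: cid. Qed.

Lemma tlift_sum (f : M -> N -> P) t : bilinear_map f ->
  tlift f t = \sum_(p <- tdecomp t) f p.1 p.2.
Proof.
case/tlift_linear=> fl fE; rewrite {1}(tdecompE t) (linfun_sum _ _ fl).
by apply: eq_bigr => p _; apply: fE.
Qed.

Lemma linear_eq_tens (f g : tensor M N -> P) : linear f -> linear g ->
  (forall m n, f (tens m n) = g (tens m n)) -> f =1 g.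
Proof.
move=> fl gl fg t; rewrite (tdecompE t).
rewrite (linfun_sum _ _ fl) (linfun_sum _ _ gl).
by apply: eq_bigr => p _; apply: fg.
Qed.
End Decomposition.

Section Coassociativity.
Variables A B C D E W : lmodType k.

Definition trilinear (f : A -> B -> C -> W) :=
  [/\ forall b c, linear (fun a => f a b c), forall a c, linear (fun b => f a b c)
    & forall a b, linear (fun c => f a b c)].

(** Coassociativity in Sweedler form. With l = r = Delta it lets a0, a1, a2
    stand for either bracketing in a trilinear expression; with l = rho and
    r = Delta it does so for a coaction. *)
Lemma tassoc_sum (l : {linear D -> tensor A B}) (r : {linear E -> tensor B C})
    (t : tensor D C) (u : tensor A E) (f : A -> B -> C -> W) : trilinear f ->
    tassoc (tmap l idfun t) = tmap idfun r u ->
  \sum_(p <- tdecomp t) \sum_(q <- tdecomp (l p.1)) f q.1 q.2 p.2 =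
  \sum_(p <- tdecomp u) \sum_(q <- tdecomp (r p.2)) f p.1 q.1 q.2.
Proof.
case=> fA fB fC tu.
have fbil a : bilinear_map (f a) by split; [move=> c; apply: fB | apply: fC].
have f2 a := tlift_linear (fbil a).
have Fbil : bilinear_map (fun a => tlift (f a)).
  split=> [n c x y|a]; last exact: (f2 a).1.
  rewrite !tlift_sum//  scaler_sumr -big_split; apply: eq_bigr => p _ /=.
  exact: fA.
have [FL FE] := tlift_linear Fbil.
(* Both sums are the value at tu of the linear map on A (x) (B (x) C) that
   f induces. *)
transitivity (tlift (fun a => tlift (f a)) (tassoc (tmap l idfun t))).
  have Abil : bilinear_map (fun (s : tensor A B) (p : C) =>
      tlift (fun m n => tens m (tens n p)) s).
    have b2 (p : C) : bilinear_map (fun (m : A) (n : B) => tens m (tens n p)).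
      split=> [n c x y|m c x y]; first by rewrite tensDl tensZl.
      by rewrite tensDl tensDr tensZl tensZr.
    split=> [p|s c x y]; first exact: (tlift_linear (b2 p)).1.
    rewrite !tlift_sum// scaler_sumr -big_split; apply: eq_bigr => p _ /=.
    by rewrite tensDr tensDr !tensZr.
  have Mbil : bilinear_map (fun (m : D) (n : C) => tens (l m) (idfun n)).
    split=> [n c x y|m c x y]; first by rewrite linearP tensDl tensZl.
    by rewrite /= tensDr tensZr.
  rewrite /tmap (tlift_sum _ Mbil) /tassoc.
  rewrite (linfun_sum _ _ (tlift_linear Abil).1) (linfun_sum _ _ FL).
  apply: eq_bigr => p _ /=; rewrite (tlift_linear Abil).2.
  rewrite {2}(tdecompE (l p.1)).
  have b2 : bilinear_map (fun (m : A) (n : B) => tens m (tens n p.2)).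
    split=> [n c x y|m c x y]; first by rewrite tensDl tensZl.
    by rewrite tensDl tensDr tensZl tensZr.
  rewrite (linfun_sum _ _ (tlift_linear b2).1) (linfun_sum _ _ FL).
  apply: eq_bigr => q _ /=; rewrite (tlift_linear b2).2 FE.
  by rewrite (f2 _).2.
have Mbil : bilinear_map (fun (m : A) (n : E) => tens (idfun m) (r n)).
  split=> [n c x y|m c x y]; first by rewrite /= tensDl tensZl.
  by rewrite linearP tensDr tensZr.
rewrite tu /tmap (tlift_sum _ Mbil) (linfun_sum _ _ FL).
by apply: eq_bigr => p _ /=; rewrite FE tlift_sum.
Qed.
End Coassociativity.

(** Multiplicativity of Delta and of rho in Sweedler form:
    (ab)0 (x) (ab)1 = a0 b0 (x) a1 b1 under any bilinear map. *)
Lemma tmul_sum (A B : algType k) (W : lmodType k) (s t : tensor A B)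
    (f : A -> B -> W) : bilinear_map f ->
  \sum_(p <- tdecomp (tmul s t)) f p.1 p.2 =
  \sum_(p <- tdecomp s) \sum_(q <- tdecomp t) f (p.1 * q.1) (p.2 * q.2).
Proof.
move=> fbil; rewrite -(tlift_sum _ fbil); have [FL FE] := tlift_linear fbil.
have b1 a b : bilinear_map (fun (a' : A) (b' : B) => tens (a * a') (b * b')).
  split=> [n c x y|m c x y]; first by rewrite mulrDr tensDl -scalerAr tensZl.
  by rewrite mulrDr tensDr -scalerAr tensZr.
have b2 : bilinear_map (fun (a : A) (b : B) =>
    tlift (fun a' b' => tens (a * a') (b * b')) t).
  split=> [n c x y|m c x y]; rewrite !tlift_sum// scaler_sumr -big_split;
    apply: eq_bigr => p _ /=.
    by rewrite mulrDl tensDl -scalerAl tensZl.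
  by rewrite mulrDl tensDr -scalerAl tensZr.
rewrite /tmul (tlift_sum _ b2) (linfun_sum _ _ FL); apply: eq_bigr => p _.
rewrite (tlift_sum _ (b1 _ _)) (linfun_sum _ _ FL); apply: eq_bigr => q _.
exact: FE.
Qed.
End Sweedler.

(** * The antipode reverses products *)

Section Antipode.
Variables (k : comNzRingType) (H : hopfAlgType k).
Notation Delta h := (tdecomp (comul h)).

Lemma counitl_sum (W : lmodType k) (f : H -> W) (h : H) : linear f ->
  \sum_(p <- Delta h) (counit p.1 : k) *: f p.2 = f h.
Proof.
move=> fl; rewrite -[in RHS](comulL h) tlift_sum.
  rewrite (linfun_sum _ _ fl); apply: eq_bigr => p _.
  by rewrite (linfunZ _ _ fl).
split=> [b c x y|a c x y]; first by rewrite linearP scalerDl scalerA.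
by rewrite scalerDr !scalerA mulrC.
Qed.

Lemma counitr_sum (W : lmodType k) (f : H -> W) (h : H) : linear f ->
  \sum_(p <- Delta h) (counit p.2 : k) *: f p.1 = f h.
Proof.
move=> fl; rewrite -[in RHS](comulR h) tlift_sum.
  rewrite (linfun_sum _ _ fl); apply: eq_bigr => p _.
  by rewrite (linfunZ _ _ fl).
split=> [b c x y|a c x y]; last by rewrite linearP scalerDl scalerA.
by rewrite scalerDr !scalerA mulrC.
Qed.

Lemma antipodel_sum (h : H) :
  \sum_(p <- Delta h) antipode p.1 * p.2 = (counit h : k)%:A.
Proof.
rewrite -antipodeL tlift_sum//.
split=> [b c x y|a c x y]; first by rewrite linearP mulrDl -scalerAl.
by rewrite mulrDr -scalerAr.
Qed.

Lemma antipoder_sum (h : H) :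
  \sum_(p <- Delta h) p.1 * antipode p.2 = (counit h : k)%:A.
Proof.
rewrite -antipodeR tlift_sum//.
split=> [b c x y|a c x y]; first by rewrite mulrDl -scalerAl.
by rewrite linearP mulrDr -scalerAr.
Qed.

(** In the convolution algebra of maps H (x) H -> H, the multiplication has
    x (x) y |-> S(xy) as a left inverse and x (x) y |-> S(y) S(x) as a right
    inverse, so the two coincide. Concretely, the sum of
      S(x1 y1) (x2 y2) (S(y3) S(x3))
    is evaluated once by cancelling its first two factors and once by
    cancelling its last two. *)
Lemma antipodeM (x y : H) : antipode (x * y) = antipode y * antipode x :> H.
Proof.
pose S := @antipode k H.
have cancelL (a b : H) : \sum_(q <- Delta a) \sum_(q' <- Delta b)
    S (q.1 * q'.1) * (q.2 * q'.2) = (counit a : k) *: (counit b : k)%:A.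
  pose f (u v : H) : H := S u * v.
  have fbil : bilinear_map f.
    split=> [n c u v|m c u v]; rewrite /f.
      by rewrite linearP mulrDl -scalerAl.
    by rewrite mulrDr -scalerAr.
  rewrite -(tmul_sum (comul a) (comul b) fbil) -comulM antipodel_sum.
  by rewrite scalerA rmorphM.
have cancelR (a b : H) : \sum_(q <- Delta a) \sum_(q' <- Delta b)
    (q.1 * q'.1) * (S q'.2 * S q.2) = (counit a : k) *: (counit b : k)%:A.
  transitivity (\sum_(q <- Delta a) (counit b : k) *: (q.1 * S q.2)).
    apply: eq_bigr => q _; under eq_bigr do rewrite mulrA -(mulrA q.1).
    rewrite -mulr_suml -mulr_sumr antipoder_sum.
    by rewrite -scalerAr mulr1 -scalerAl.
  by rewrite -scaler_sumr antipoder_sum !scalerA mulrC.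
pose g a b c a' b' c' : H := S (a * a') * (b * b') * (S c' * S c).
have g1 (a b c : H) : trilinear (g a b c).
  split=> m n e u v; rewrite /g.
  - by rewrite mulrDr -scalerAr linearP !mulrDl -!scalerAl.
  - by rewrite !mulrDr -!scalerAr !mulrDl -!scalerAl.
  - by rewrite linearP !mulrDl -!scalerAl !mulrDr -!scalerAr.
have g2 (a' b' c' : H) : trilinear (fun a b c => g a b c a' b' c').
  split=> m n e u v; rewrite /g.
  - by rewrite mulrDl -scalerAl linearP !mulrDl -!scalerAl.
  - by rewrite mulrDl mulrDr !mulrDl -!(scalerAl, scalerAr).
  - by rewrite linearP !mulrDr -!scalerAr.
pose G a b c := \sum_(p <- Delta y) \sum_(q <- Delta p.1) g a b c q.1 q.2 p.2.
have Gtri : trilinear G.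
  split=> u v c w z; rewrite /G scaler_sumr -big_split; apply: eq_bigr => p _ /=;
    rewrite scaler_sumr -big_split; apply: eq_bigr => q _ /=;
    have [gA gB gC] := g2 q.1 q.2 p.2; [exact: gA|exact: gB|exact: gC].
have linL (z : H) : linear (fun u => S (u * z)).
  by move=> c u v; rewrite mulrDl -scalerAl linearP.
have linR (z : H) : linear (fun u => S (z * u)).
  by move=> c u v; rewrite mulrDr -scalerAr linearP.
have linSl (z : H) : linear (fun u => S z * S u).
  by move=> c u v; rewrite linearP mulrDr -scalerAr.
have linSr (z : H) : linear (fun u => S u * S z).
  by move=> c u v; rewrite linearP mulrDl -scalerAl.
transitivity (\sum_(p <- Delta x) \sum_(q <- Delta p.2) G p.1 q.1 q.2).
  rewrite -[LHS](counitr_sum x (linL y)); apply: eq_bigr => p _.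
  under eq_bigr => q _ do rewrite /G (tassoc_sum (g1 _ _ _) (comulA y)).
  rewrite exchange_big -(counitr_sum y (linR p.1)).
  rewrite scaler_sumr; apply: eq_bigr => p' _ /=; rewrite /g.
  under eq_bigr => q _.
    under eq_bigr => q' _ do rewrite -mulrA.
    rewrite -mulr_sumr; over.
  by rewrite -mulr_sumr cancelR -!scalerAr mulr1.
rewrite -(tassoc_sum Gtri (comulA x)) -[RHS](counitl_sum x (linSl y)).
apply: eq_bigr => p _; rewrite /G exchange_big -(counitl_sum y (linSr p.2)).
rewrite scaler_sumr; apply: eq_bigr => p' _ /=; rewrite /g.
under eq_bigr => q _ do rewrite -mulr_suml.
by rewrite -mulr_suml cancelL -!scalerAl mul1r.
Qed.
End Antipode.

(** * Trace forms acting on T(B) *)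

Section TraceAction.
Variables (k : comNzRingType) (H : hopfAlgType k) (B : comodAlgType H).
Notation rho b := (tdecomp (coact b : tensor B H)).

Lemma rho_counit (W : lmodType k) (f : B -> W) (b : B) : linear f ->
  \sum_(p <- rho b) (counit p.2 : k) *: f p.1 = f b.
Proof.
move=> fl; rewrite -[in RHS](coactR b) tlift_sum.
  rewrite (linfun_sum _ _ fl); apply: eq_bigr => p _.
  by rewrite (linfunZ _ _ fl).
split=> [h c x y|a c x y]; last by rewrite linearP scalerDl scalerA.
by rewrite scalerDr !scalerA mulrC.
Qed.

(** The action b.f of the dual of H on B, for f any linear form. *)
Definition antipode_act (f : H -> k^o) (b : B) : B :=
  tlift (fun (b0 : B) (b1 : H) => (f (antipode b1) : k) *: b0) (coact b).

Lemma antipode_act_bilinear (f : H -> k^o) : linear f ->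
  @bilinear_map k B H B (fun (b0 : B) (b1 : H) => (f (antipode b1) : k) *: b0).
Proof.
move=> fl; split=> [h c x y|b c x y].
  by rewrite scalerDr !scalerA mulrC.
by rewrite linearP fl scalerDl scalerA.
Qed.

Lemma antipode_actE (f : H -> k^o) b : linear f ->
  antipode_act f b = \sum_(p <- rho b) (f (antipode p.2) : k) *: p.1.
Proof. by move=> fl; rewrite /antipode_act (tlift_sum _ (antipode_act_bilinear fl)). Qed.

Lemma antipode_act_linear (f : H -> k^o) : linear f ->
  linear (antipode_act f : (B : lmodType k) -> (B : lmodType k)).
Proof.
move=> fl c x y; rewrite /antipode_act linearP.
exact: (tlift_linear (antipode_act_bilinear fl)).1.
Qed.

Lemma antipode_actD (f : H -> k^o) : linear f -> {morph antipode_act f : x y / x + y}.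
Proof. by move=> fl; apply: (linearD (lin_of (antipode_act_linear fl))). Qed.

Lemma tr_sum (R : nzRingType) I (s : seq I) (F : I -> R) :
  tr (\sum_(i <- s) F i) = \sum_(i <- s) tr (F i).
Proof. exact: (big_morph _ (@trD R) (@tr0 R)). Qed.

Lemma trB (R : nzRingType) (x y : R) : tr (x - y) = tr x - tr y.
Proof. exact: (linearB (quotpi (@commutators R))). Qed.

Lemma trform_linear (f : trform H) : linear f.
Proof. by have /asboolP[] := valP f. Qed.

Lemma trformC (f : trform H) x y : f (x * y) = f (y * x).
Proof. by have /asboolP[_ ft] := valP f; apply: ft. Qed.

Lemma antipode_actM (f : H -> k^o) (x y : B) : linear f ->
  antipode_act f (x * y) =
  \sum_(p <- rho x) \sum_(q <- rho y) (f (antipode (p.2 * q.2)) : k) *: (p.1 * q.1).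
Proof.
move=> fl; rewrite antipode_actE// coactM.
exact: (@tmul_sum _ _ _ _ (coact x) (coact y) _ (antipode_act_bilinear fl)).
Qed.

(** The stability of [B, B] under trace forms: in
    (ab).f = sum a0 b0 f(S(a1 b1)), the factors a0 and b0 commute under T,
    while S(a1 b1) = S(b1) S(a1) and S(b1 a1) = S(a1) S(b1) have the same
    value under f. *)
Lemma tr_antipode_actC (f : trform H) (a b : B) :
  tr (antipode_act f (a * b)) = tr (antipode_act f (b * a)).
Proof.
have fl := trform_linear f.
have expand (x y : B) : tr (antipode_act f (x * y)) =
    \sum_(p <- rho x) \sum_(q <- rho y)
      tr ((f (antipode (p.2 * q.2)) : k) *: (p.1 * q.1)).
  rewrite antipode_actM//.
  by rewrite tr_sum; apply: eq_bigr => p _; rewrite tr_sum.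
rewrite !expand exchange_big; apply: eq_bigr => q _; apply: eq_bigr => p _ /=.
by rewrite !antipodeM trformC scalerAl trC -scalerAr.
Qed.

Lemma tr_actE (b : B) (f : trform H) : tr_act (tr b) f = tr (antipode_act f b).
Proof.
have fl := trform_linear f.
have gl : linear (fun b : zmodule B => tr (antipode_act f b)).
  by apply: additive_linear => x y; rewrite antipode_actD// trD.
apply: (quotliftE (g := lin_of gl)) => u [x [y ->]] /=.
have -> : antipode_act f (x * y - y * x : B) =
    antipode_act f (x * y) - antipode_act f (y * x).
  by apply/eqP; rewrite eq_sym subr_eq -antipode_actD// subrK.
by rewrite trB tr_antipode_actC subrr.
Qed.

Lemma hstraceP (R : nzRingType) (x : hstrace R) : exists b : R, x = tr b.
Proof. by exists (quotrepr x); rewrite /tr quotreprK. Qed.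

Lemma tr_act_bilinear : @bilinear_map int (hstrace B) (zmodule (trform H)) (hstrace B)
  (fun x f => tr_act x f).
Proof.
split=> [f|x]; apply: additive_linear.
  move=> x y; have [a ->] := hstraceP x; have [b ->] := hstraceP y.
  by rewrite -trD !tr_actE antipode_actD ?trD//; apply: trform_linear.
move=> f g; have [b ->] := hstraceP x; rewrite !tr_actE -trD; congr tr.
rewrite !antipode_actE; try exact: trform_linear.
rewrite -big_split; apply: eq_bigr => p _ /=.
by rewrite -scalerDl.
Qed.

Lemma tr_act_suml I (s : seq I) (F : I -> hstrace B) (f : trform H) :
  tr_act (\sum_(i <- s) F i) f = \sum_(i <- s) tr_act (F i) f.
Proof. exact: (linfun_sum _ _ (tr_act_bilinear.1 f)). Qed.

End TraceAction.

(** * Dual bases of a diagonal tensor product *)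

Section DiagonalBases.
Variables (k : comNzRingType) (H : hopfAlgType k) (B : comodAlgType H).
Variables (M : lmodType B) (V : lmodType H).
Notation rho b := (tdecomp (coact b : tensor B H)).
Notation MV := (tensor (restr M) (restr V)).

Lemma restr_actl (m : M) : linear (fun b : (B : lmodType k) => (b : B) *: m : restr M).
Proof. by move=> c x y; rewrite scalerDl algZl. Qed.

Lemma restr_actr (b : B) : linear (fun m : restr M => b *: (m : M) : restr M).
Proof. by move=> c x y; rewrite scalerDr algZC. Qed.

Lemma hact_linearl (v : restr V) : linear (fun h : H => hact h v).
Proof. by move=> c x y; rewrite /hact scalerDl algZl. Qed.

Lemma diag_bilinear (m : M) (v : V) : @bilinear_map k B H MV
  (fun b h => tens (b *: m : restr M) (hact h v)).
Proof.
split=> [h c x y|b c x y]; first by rewrite restr_actl tensDl tensZl.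
by rewrite hact_linearl tensDr tensZr.
Qed.

Lemma diag_scale_tlift (b : B) (m : M) (v : V) : b *: diag_tens m v =
  tlift (fun (b : B) (h : H) => tens (b *: m : restr M) (hact h v)) (coact b) :> MV.
Proof.
congr tlift; apply/funext => a; apply/funext => h.
apply: (tlift_linear _).2; split=> [n c x y|x c y z].
  by rewrite restr_actr tensDl tensZl.
by rewrite -[_ *: (_ + _)]/(hact h _) hact_linear tensDr tensZr.
Qed.

Lemma diag_scaleE (b : B) (m : M) (v : V) : b *: diag_tens m v =
  \sum_(p <- rho b) tens (p.1 *: m : restr M) (hact p.2 v) :> MV.
Proof. by rewrite diag_scale_tlift (tlift_sum _ (diag_bilinear m v)). Qed.

Lemma diag_scale_linear (m : M) (v : V) :
  linear (fun b : (B : lmodType k) => (b : B) *: diag_tens m v : MV).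
Proof.
move=> c x y; rewrite !diag_scale_tlift linearP.
exact: (tlift_linear (diag_bilinear m v)).1.
Qed.

Section Functional.
Variables (f : {linear M -> B^o}) (g : {linear restr V -> k^o}).

(** The dual basis form attached to f and g:
    m (x) v |-> sum a0 g(S(a1) v) with a = f(m). It is the untwisting
    b (x) v |-> b0 (x) S(b1) v preceded by f (x) id and followed by id (x) g. *)
Definition diag_form : MV -> B :=
  tlift (fun (m : restr M) (v : restr V) =>
    antipode_act (fun h => g (hact h v)) (f m)).

Lemma coef_linear (v : restr V) : linear (fun h : H => g (hact h v)).
Proof. by move=> c x y; rewrite hact_linearl linearP. Qed.

Lemma diag_form_bilinear : @bilinear_map k (restr M) (restr V) B
  (fun (m : restr M) (v : restr V) => antipode_act (fun h => g (hact h v)) (f m)).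
Proof.
split=> [v c x y|m c x y].
  have -> : f (c *: x + y) = c *: f x + f y :> B.
    by rewrite -mulr_algl; apply: (linearP f c%:A x y).
  exact: (antipode_act_linear (coef_linear v)).
rewrite !antipode_actE; try exact: coef_linear.
rewrite scaler_sumr -big_split; apply: eq_bigr => p _ /=.
by rewrite hact_linear linearP scalerDl scalerA.
Qed.

Lemma diag_formE (m : M) (v : V) :
  diag_form (diag_tens m v) =
  \sum_(q <- rho (f m)) (g (hact (antipode q.2) v) : k) *: q.1.
Proof.
rewrite [LHS](tlift_linear diag_form_bilinear).2 antipode_actE//.
exact: coef_linear.
Qed.

Lemma diag_form_klinear : linear (diag_form : MV -> (B : lmodType k)).
Proof. exact: (tlift_linear diag_form_bilinear).1. Qed.

Lemma diag_formD : {morph diag_form : s t / s + t}.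
Proof. exact: (linearD (lin_of diag_form_klinear)). Qed.

Lemma diag_form0 : diag_form 0 = 0.
Proof. exact: (linear0 (lin_of diag_form_klinear)). Qed.

(** For a = f(m), the value at b0 m (x) b1 v is the sum of
    b0 a0 g(S(b1 a1) b2 v) = b0 a0 g(S(a1) S(b1) b2 v), and S(b1) b2 collapses
    to a counit. *)
Lemma diag_formZ (b : B) (t : diag_tensor M V) :
  diag_form (b *: t) = b * diag_form t.
Proof.
elim/tensor_ind: t => [|m v t IH]; first by rewrite scaler0 diag_form0 mulr0.
rewrite [b *: _]scalerDr !diag_formD IH mulrDr; congr (_ + _).
rewrite -/(diag_tens m v) diag_scaleE diag_formE.
rewrite (linfun_sum _ _ diag_form_klinear).
pose F (x : B) (y z : H) : B :=
  \sum_(q <- rho (f m)) (g (hact (antipode (y * q.2)) (hact z v)) : k) *: (x * q.1).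
transitivity (\sum_(p <- rho b) \sum_(r <- rho p.1) F r.1 r.2 p.2).
  apply: eq_bigr => p _.
  rewrite [LHS](tlift_linear diag_form_bilinear).2 linearZ_LR.
  exact: (antipode_actM p.1 (f m) (coef_linear (hact p.2 v))).
have Ftri : trilinear F.
  split=> x y c u w; rewrite /F scaler_sumr -big_split; apply: eq_bigr => q _ /=.
  - by rewrite mulrDl scalerDr -scalerAl !scalerA mulrC.
  - rewrite mulrDl -scalerAl linearP hact_linearl linearP.
    by rewrite scalerDl scalerA.
  - by rewrite hact_linearl hact_linear linearP scalerDl scalerA.
rewrite (tassoc_sum Ftri (coactA b)).
pose G (x : B) := \sum_(q <- rho (f m)) (g (hact (antipode q.2) v) : k) *: (x * q.1).
have Gl : linear (G : (B : lmodType k) -> (B : lmodType k)).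
  move=> c u w; rewrite /G scaler_sumr -big_split; apply: eq_bigr => q _ /=.
  by rewrite mulrDl scalerDr -scalerAl !scalerA mulrC.
transitivity (G b); last first.
  by rewrite /G mulr_sumr; apply: eq_bigr => q _; rewrite scalerAr.
rewrite -(rho_counit b Gl); apply: eq_bigr => p _.
rewrite /F exchange_big scaler_sumr; apply: eq_bigr => q _ /=.
rewrite -scaler_suml scalerA; congr (_ *: _).
have -> : (counit p.2 : k) * g (hact (antipode q.2) v) =
    g (hact (antipode q.2 * (counit p.2 : k)%:A) v).
  by rewrite -scalerAr mulr1 (linfunZ _ _ (hact_linearl v)) linearZ_LR.
rewrite -antipodel_sum mulr_sumr (linfun_sum _ _ (coef_linear v)).
by apply: eq_bigr => r _; rewrite antipodeM /hact scalerA mulrA.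
Qed.

Lemma diag_form_linear : linear (diag_form : diag_tensor M V -> B^o).
Proof. by move=> b s t; rewrite diag_formD diag_formZ. Qed.
End Functional.

(** Summing over dual bases of V turns g_j(S(b2) v) v_j into S(b2) v, so the
    left side is the sum of b0 m (x) b1 S(b2) v, where b1 S(b2) collapses to a
    counit. *)
Lemma diag_expand (t : seq ({linear restr V -> k^o} * restr V)) (b : B) (m : M) (v : V) :
  dual_bases t ->
  \sum_(gy <- t) (\sum_(q <- rho b) (gy.1 (hact (antipode q.2) v) : k) *: q.1)
     *: diag_tens m gy.2 = diag_tens (b *: m) v.
Proof.
move=> tP.
pose F (x : B) (y z : H) : MV := tens (x *: m : restr M) (hact y (hact (antipode z) v)).
have Ftri : trilinear F.
  split=> x y c u w; rewrite /F.
  - by rewrite restr_actl tensDl tensZl.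
  - by rewrite hact_linearl tensDr tensZr.
  - by rewrite linearP hact_linearl hact_linear tensDr tensZr.
transitivity (\sum_(q <- rho b) \sum_(r <- rho q.1) F r.1 r.2 q.2 : MV).
  under eq_bigr => gy _ do rewrite (linfun_sum _ _ (diag_scale_linear m gy.2)).
  rewrite exchange_big; apply: eq_bigr => q _ /=.
  under eq_bigr => gy _.
    rewrite (linfunZ _ _ (diag_scale_linear m gy.2)) diag_scaleE scaler_sumr.
    over.
  rewrite exchange_big; apply: eq_bigr => r _ /=.
  rewrite /F [in RHS](tP (hact (antipode q.2) v)) (linfun_sum _ _ (hact_linear r.2)).
  rewrite (linfun_sum _ _ ((tens_bilinear _ _).2 _)).
  by apply: eq_bigr => gy _; rewrite (linfunZ _ _ (hact_linear r.2)) tensZr.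
rewrite (tassoc_sum Ftri (coactA b)).
have bl : linear (fun b : B => tens (b *: m : restr M) (v : restr V)).
  by move=> c x y; rewrite restr_actl tensDl tensZl.
rewrite -[RHS](rho_counit b bl); apply: eq_bigr => p _.
rewrite -tensZr /F -(linfun_sum _ _ ((tens_bilinear _ _).2 _)); congr tens.
have v1 : v = hact 1 v by rewrite /hact scale1r.
rewrite [X in _ = _ *: X]v1.
rewrite -(linfunZ _ _ (hact_linearl v)) -antipoder_sum.
rewrite (linfun_sum _ _ (hact_linearl v)); apply: eq_bigr => r _.
by rewrite /hact scalerA.
Qed.

Definition diag_dual_bases (s : seq ({linear M -> B^o} * M))
    (t : seq ({linear restr V -> k^o} * restr V)) :
    seq ({linear diag_tensor M V -> B^o} * diag_tensor M V) :=
  [seq (lin_of (diag_form_linear fx.1 gy.1), diag_tens fx.2 gy.2) | fx <- s, gy <- t].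

Lemma diag_dual_basesP s t : dual_bases s -> dual_bases t ->
  dual_bases (diag_dual_bases s t).
Proof.
move=> sP tP; rewrite /dual_bases /diag_dual_bases => w.
rewrite big_allpairs_dep /=.
elim/tensor_ind: w => [|m v w IH].
  rewrite big1 // => fx _; rewrite big1 // => gy _.
  by rewrite diag_form0 scale0r.
rewrite [X in _ + X = _]IH.
under [RHS]eq_bigr => fx _.
  under eq_bigr => gy _ do rewrite diag_formD scalerDl.
  rewrite big_split; over.
rewrite big_split; congr (_ + _) => /=.
under eq_bigr => fx _.
  under eq_bigr => gy _ do rewrite -/(diag_tens m v) diag_formE.
  rewrite diag_expand//; over.
rewrite {1}(sP m).
exact: (linfun_sum _ _ ((tens_bilinear (restr M) (restr V)).1 v)).
Qed.

Lemma hsrank_diag_tensor (s : seq ({linear M -> B^o} * M))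
    (t : seq ({linear restr V -> k^o} * restr V)) : dual_bases s -> dual_bases t ->
  hsrank (diag_tensor M V) = tr_act (hsrank M) (character V).
Proof.
move=> sP tP; rewrite (hsrankE (diag_dual_basesP sP tP)) (hsrankE sP).
rewrite big_allpairs_dep /= tr_act_suml; apply: eq_bigr => fx _.
rewrite tr_actE antipode_actE; last exact: trform_linear.
rewrite -tr_sum; congr tr.
under eq_bigr => gy _ do rewrite diag_formE.
rewrite exchange_big; apply: eq_bigr => q _ /=.
rewrite -(@linfun_sum k k^o B (fun c => (c : k) *: q.1)) => [|c x y].
  by rewrite /character_fun (mod_traceE _ tP).
by rewrite scalerDl scalerA.
Qed.
End DiagonalBases.

(** * Split exact sequences and dual bases *)

Section ShortExact.
Variables (R : nzRingType) (M1 M2 M3 : lmodType R).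

Definition short_exact (i : M1 -> M2) (p : M2 -> M3) :=
  [/\ injective i, forall z, exists y, p y = z
    & forall y, p y = 0 <-> exists x, i x = y].

(** M2 = M1 (+) M3 as witnessed by the injections i, s and the projections
    q, p. Only the underlying functions enter, so that one splitting can be
    read over B or over k. *)
Definition splitting (i : M1 -> M2) (p : M2 -> M3) (q : M2 -> M1) (s : M3 -> M2) :=
  [/\ cancel i q, cancel s p & forall y, i (q y) + s (p y) = y].

Lemma short_exact_splitting (i : {linear M1 -> M2}) (p : {linear M2 -> M3}) :
    projective M3 -> short_exact i p ->
  exists (q : {linear M2 -> M1}) (s : {linear M3 -> M2}), splitting i p q s.
Proof.
move=> pr3 [iI pS ip]; have [s sK] := pr3 M2 M3 p idfun pS.
have kerP y : exists x, i x = y - s (p y).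
  by apply/ip; rewrite linearB; have /= -> := sK (p y); rewrite subrr.
pose q y := sval (cid (kerP y)).
have qE y : i (q y) = y - s (p y) by rewrite /q; case: cid.
have ql : linear q.
  move=> c x y; apply: iI; rewrite (linearP i) !qE (linearP p) (linearP s).
  by rewrite scalerBr opprD addrACA.
exists (lin_of ql), s; split=> [x|z|y] /=.
- apply: iI; rewrite qE; have -> : p (i x) = 0 by apply/ip; exists x.
  by rewrite linear0 subr0.
- exact: sK.
- by rewrite qE subrK.
Qed.

(** Here q and s are bare functions because a sequence of H-modules that
    splits only over k gives the diagonal tensor products a splitting that is
    k-linear but in general not B-linear. *)
Lemma splitting_short_exact (i : {linear M1 -> M2}) (p : {linear M2 -> M3})
    (q : M2 -> M1) (s : M3 -> M2) :
  q 0 = 0 -> s 0 = 0 -> splitting i p q s -> short_exact i p.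
Proof.
move=> q0 s0 [iK sK split1]; split=> [|z|y]; first exact: can_inj iK.
  by exists (s z).
split=> [py|[x <-]]; first by exists (q y); rewrite -[RHS]split1 py s0 addr0.
have := split1 (i x); rewrite iK -[RHS]addr0 => /addrI sp.
by rewrite -(sK (p (i x))) sp linear0.
Qed.

End ShortExact.

Section FgProj.
Variable R : nzRingType.

Lemma dual_bases_fgproj (P : lmodType R) (s : seq ({linear P -> R^o} * P)) :
  dual_bases s -> fgproj P.
Proof.
move=> sP; split.
  exists (size s), (fun i => (tnth (in_tuple s) i).2) => v.
  exists (fun i => (tnth (in_tuple s) i).1 v); rewrite {1}(sP v).
  by rewrite (big_tnth _ _ s).
move=> X Y p f pS; pose l y := sval (cid (pS y)).
have lE y : p (l y) = y by rewrite /l; case: cid.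
pose g v := \sum_(fx <- s) fx.1 v *: l (f fx.2).
have gl : linear g.
  move=> c u v; rewrite /g scaler_sumr -big_split; apply: eq_bigr => fx _ /=.
  by rewrite linearP scalerDl scalerA.
exists (lin_of gl) => v /=; rewrite /g linear_sum [in RHS](sP v) linear_sum.
by apply: eq_bigr => fx _; rewrite !linearZ_LR lE.
Qed.

Lemma fin_gen_quot (P : lmodType R) : fin_gen P ->
  exists n (p : {linear 'rV[R]_n -> P}), forall y, exists x, p x = y.
Proof.
case=> n [x xP]; pose p (c : 'rV[R]_n) := \sum_i c 0 i *: x i.
have pl : linear p.
  move=> c u v; rewrite /p scaler_sumr -big_split; apply: eq_bigr => i _ /=.
  by rewrite !mxE scalerDl scalerA.
exists n, (lin_of pl) => y; have [c ->] := xP y; exists (\row_i c i) => /=.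
by apply: eq_bigr => i _; rewrite mxE.
Qed.

Lemma fgproj_dual_bases (P : lmodType R) : fgproj P ->
  exists s : seq ({linear P -> R^o} * P), dual_bases s.
Proof.
case=> /fin_gen_quot[n [p pS]] pr; have [g gK] := pr _ _ p idfun pS.
have cl (j : 'I_n) : linear (fun v => g v 0 j : R^o).
  by move=> c u v; rewrite linearP !mxE.
exists [seq (lin_of (cl j), p (delta_mx 0 j)) | j <- enum 'I_n] => v.
rewrite big_map big_enum /= -[LHS]gK /= {1}(row_sum_delta (g v)) linear_sum.
by apply: eq_bigr => j _; rewrite linearZ_LR.
Qed.

(** Shared by isomorphisms, where b inverts a, and by direct sums, where a is
    the projection onto P and b the injection of P. *)
Definition transport_bases (P Q : lmodType R) (a : {linear Q -> P}) (b : P -> Q)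
    (t : seq ({linear P -> R^o} * P)) : seq ({linear Q -> R^o} * Q) :=
  [seq (fx.1 \o a : {linear Q -> R^o}, b fx.2) |
     fx : ({linear P -> R^o} * P)%type <- t].

Lemma iso_dual_bases (P Q : lmodType R) (e : {linear P -> Q}) (e' : {linear Q -> P})
    (s : seq ({linear P -> R^o} * P)) : cancel e' e -> dual_bases s ->
  dual_bases (transport_bases e' e s).
Proof.
move=> eK sP v; rewrite big_map -{1}(eK v) {1}(sP (e' v)) linear_sum.
by apply: eq_bigr => fx _; rewrite linearZ_LR.
Qed.

Lemma bij_linear_inv (P Q : lmodType R) (e : {linear P -> Q}) : bijective e ->
  exists e' : {linear Q -> P}, cancel e e' /\ cancel e' e.
Proof.
case=> g eK gK; have gl : linear g.
  by move=> c x y; apply: (can_inj eK); rewrite linearP !gK.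
by exists (lin_of gl).
Qed.

Lemma fgproj_iso (P Q : lmodType R) (e : {linear P -> Q}) : bijective e ->
  fgproj P -> fgproj Q.
Proof.
move=> /bij_linear_inv[e' [eK e'K]] /fgproj_dual_bases[s sP].
exact: (dual_bases_fgproj (iso_dual_bases e'K sP)).
Qed.

Lemma hsrank_iso (P Q : lmodType R) (e : {linear P -> Q}) : bijective e ->
  fgproj P -> hsrank P = hsrank Q.
Proof.
move=> /bij_linear_inv[e' [eK e'K]] /fgproj_dual_bases[s sP].
rewrite (hsrankE sP) (hsrankE (iso_dual_bases e'K sP)) big_map.
by apply: eq_bigr => fx _ /=; rewrite eK.
Qed.

Lemma splitting_dual_bases (M1 M2 M3 : lmodType R)
    (i : {linear M1 -> M2}) (p : {linear M2 -> M3})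
    (q : {linear M2 -> M1}) (s : {linear M3 -> M2})
    (t1 : seq ({linear M1 -> R^o} * M1)) (t3 : seq ({linear M3 -> R^o} * M3)) :
    splitting i p q s -> dual_bases t1 -> dual_bases t3 ->
  dual_bases (transport_bases q i t1 ++ transport_bases p s t3).
Proof.
move=> [_ _ split1] t1P t3P v; rewrite big_cat !big_map -{1}(split1 v).
rewrite {1}(t1P (q v)) {1}(t3P (p v)) !linear_sum.
by congr (_ + _); apply: eq_bigr => fx _; rewrite linearZ_LR.
Qed.

Lemma hsrank_short_exact (M1 M2 M3 : lmodType R)
    (i : {linear M1 -> M2}) (p : {linear M2 -> M3}) :
  fgproj M1 -> fgproj M3 -> short_exact i p -> hsrank M2 = hsrank M1 + hsrank M3.
Proof.
move=> fg1 fg3 ip; have [q [s qs]] := short_exact_splitting fg3.2 ip.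
have [t1 t1P] := fgproj_dual_bases fg1; have [t3 t3P] := fgproj_dual_bases fg3.
rewrite (hsrankE (splitting_dual_bases qs t1P t3P)) (hsrankE t1P) (hsrankE t3P).
rewrite big_cat !big_map; case: qs => iK sK _.
by congr (_ + _); apply: eq_bigr => fx _ /=; rewrite ?iK ?sK.
Qed.
End FgProj.

Section RestrictionLinear.
Variables (k : comNzRingType) (A : algType k).

(** A separate name for f, to carry a k-linear structure besides the A-linear
    one. *)
Definition restr_fun (M N : lmodType A) (f : {linear M -> N}) :
  restr M -> restr N := f.

Lemma restr_fun_linear (M N : lmodType A) (f : {linear M -> N}) :
  linear (restr_fun f).
Proof. by move=> c x y; apply: (linearP f c%:A x y). Qed.
HB.instance Definition _ (M N : lmodType A) (f : {linear M -> N}) :=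
  GRing.isLinear.Build k (restr M) (restr N) *:%R (restr_fun f) (restr_fun_linear f).

(** The splitting q, s is only k-linear, but i and p commute with h in A, so
    q (h (i v)) = h v and p (h (s w)) = h w on the dual bases of V2 built from
    those of V1 and V3. *)
Lemma character_short_exact (V1 V2 V3 : lmodType A)
    (i : {linear V1 -> V2}) (p : {linear V2 -> V3}) :
    fgproj (restr V1) -> fgproj (restr V3) -> short_exact i p ->
  character V2 = character V1 + character V3.
Proof.
move=> fg1 fg3 ip.
have [q [s qs]] := short_exact_splitting (i := restr_fun i) (p := restr_fun p) fg3.2 ip.
have [t1 t1P] := fgproj_dual_bases fg1; have [t3 t3P] := fgproj_dual_bases fg3.
apply: val_inj; apply/funext => h.
transitivity (character_fun V1 h + character_fun V3 h); last by [].
rewrite -[LHS]/(character_fun V2 h).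
rewrite /character_fun (mod_traceE _ (splitting_dual_bases qs t1P t3P)).
rewrite /character_fun (mod_traceE _ t1P) (mod_traceE _ t3P).
rewrite big_cat !big_map; case: qs => iK sK _.
have equiv (U W : lmodType A) (f : {linear U -> W}) (v : restr U) :
    hact h (restr_fun f v) = restr_fun f (hact h v).
  by apply: esym; apply: (linearZ_LR f h v).
congr (_ + _); apply: eq_bigr => fx _; congr (fx.1 _).
  by rewrite /= equiv iK.
by rewrite -[in RHS](sK fx.2) /= equiv.
Qed.
End RestrictionLinear.

(** * Classes in Grothendieck groups *)

Section GrothendieckClasses.
Variables (R : nzRingType) (C : lmodType R -> Prop).

Lemma groth_ext (A : lmodType int) (f g : groth C -> A) : linear f -> linear g ->
  (forall c, f (presgen (@ses_rel R C) c) = g (presgen (@ses_rel R C) c)) -> f =1 g.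
Proof.
move=> fl gl fg x; rewrite -(quotreprK x).
have lin0 (h : groth C -> A) : linear h -> h 0 = 0.
  by move=> hl; apply: (linear0 (lin_of hl)).
elim/freeg_ind_dom0: (quotrepr x) => [|n c D _ _ IH]; first by rewrite linear0 !lin0.
have -> : << n *g c >> = n *: << c >> :> {freeg (groth_gen C) / int}.
  by apply/eqP/freeg_eqP=> y; rewrite coeffZ !coeffU mulrA mulr1.
by rewrite linearP fl gl IH fg.
Qed.

Lemma presgen_short_exact (c1 c2 c3 : groth_gen C)
    (i : {linear groth_mod c1 -> groth_mod c2})
    (p : {linear groth_mod c2 -> groth_mod c3}) : short_exact i p ->
  presgen (@ses_rel R C) c2 =
    presgen (@ses_rel R C) c1 + presgen (@ses_rel R C) c3 :> groth C.
Proof.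
case=> iI pS ip; apply/eqP; rewrite -linearD quotpi_eq.
by apply: submod_span_gen; apply: SesRel ip.
Qed.

Hypothesis C_fin_gen : forall M, C M -> fin_gen M.
Hypothesis C_iso : forall (M N : lmodType R) (f : {linear M -> N}),
  bijective f -> C M -> C N.

(** M is a quotient of R^n by the kernel of a surjection, which serves as the
    set of relations. *)
Lemma groth_gen_iso (M : lmodType R) : C M ->
  exists (c : groth_gen C) (f : {linear groth_mod c -> M}), bijective f.
Proof.
move=> CM; have [n [p pS]] := fin_gen_quot (C_fin_gen CM).
pose c := ModPres (fun v => p v = 0).
have liftE v : quotlift p (quotpi (@modpres_rel R c) v) = p v.
  exact: quotliftE.
have fl : linear (quotlift p : pmod c -> M).
  move=> a x y; rewrite -(quotreprK x) -(quotreprK y).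
  by rewrite -[in LHS]linearP !liftE linearP.
pose f := lin_of fl.
have fI : injective f.
  move=> x y; rewrite -(quotreprK x) -(quotreprK y) /= !liftE => pxy.
  apply/eqP; rewrite quotpi_eq; apply: submod_span_gen.
  by rewrite /= linearB pxy subrr.
pose l y := sval (cid (pS y)).
have lE y : p (l y) = y by rewrite /l; case: cid.
have lK : cancel (fun y => quotpi (@modpres_rel R c) (l y)) f.
  by move=> y; rewrite /= liftE lE.
have fbij : bijective f.
  by exists (fun y => quotpi (@modpres_rel R c) (l y)) => // x; apply: fI; rewrite lK.
have Cc : `[< C (pmod c) >].
  have [f' [fK f'K]] := bij_linear_inv fbij.
  by apply/asboolP; apply: (C_iso (f := f')) CM; exists f.
by exists (exist _ c Cc), f.
Qed.

Lemma groth_classP (M : lmodType R) : C M ->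
  exists (c : groth_gen C) (f : {linear groth_mod c -> M}),
    bijective f /\ groth_class C M = presgen (@ses_rel R C) c.
Proof.
move=> /groth_gen_iso CM; rewrite /groth_class; case: pselect => [cM|[]//].
by case: (cid cM) => c [f fbij] /=; exists c, f.
Qed.

Lemma groth_class_short_exact (M1 M2 M3 : lmodType R)
    (i : {linear M1 -> M2}) (p : {linear M2 -> M3}) :
    C M1 -> C M2 -> C M3 -> short_exact i p ->
  groth_class C M2 = groth_class C M1 + groth_class C M3.
Proof.
move=> /groth_classP[c1 [f1 [bf1 ->]]] /groth_classP[c2 [f2 [bf2 ->]]].
move=> /groth_classP[c3 [f3 [bf3 ->]]] [iI pS ip].
have [g1 [f1K g1K]] := bij_linear_inv bf1.
have [g2 [f2K g2K]] := bij_linear_inv bf2.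
have [g3 [f3K g3K]] := bij_linear_inv bf3.
pose i' : {linear groth_mod c1 -> groth_mod c2} := g2 \o i \o f1.
pose p' : {linear groth_mod c2 -> groth_mod c3} := g3 \o p \o f2.
apply: (presgen_short_exact (i := i') (p := p')); split.
- by move=> x y /(can_inj g2K) /iI /(can_inj f1K).
- by move=> z; have [y yz] := pS (f3 z); exists (g2 y); rewrite /= g2K yz f3K.
move=> y; split=> [/= py|[x <-]].
  have /ip[x xy] : p (f2 y) = 0 by apply: (can_inj g3K); rewrite py linear0.
  by exists (g1 x); rewrite /= g1K xy f2K.
rewrite /= g2K; have -> : p (i (f1 x)) = 0 by apply/ip; exists (f1 x).
exact: linear0.
Qed.
End GrothendieckClasses.

Lemma groth_mod_prop (R : nzRingType) (C : lmodType R -> Prop) (c : groth_gen C) :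
  C (groth_mod c).
Proof. by case: c => c Cc; apply/asboolP. Qed.

Section K0Class.
Variable R : nzRingType.

Lemma K0_class_short_exact (M1 M2 M3 : lmodType R)
    (i : {linear M1 -> M2}) (p : {linear M2 -> M3}) :
    fgproj M1 -> fgproj M2 -> fgproj M3 -> short_exact i p ->
  K0_class M2 = K0_class M1 + K0_class M3.
Proof.
apply: groth_class_short_exact; first by move=> M [].
exact: fgproj_iso.
Qed.

Lemma K0_rank_linear : linear (@K0_rank R) /\
  forall c : groth_gen (@fgproj R),
    K0_rank (presgen (@ses_rel R (@fgproj R)) c) = hsrank (groth_mod c).
Proof.
apply: groth_lift_linear => M1 M2 M3 i p fg1 _ fg3 iI pS ip.
exact: (hsrank_short_exact fg1 fg3 (And3 iI pS ip)).
Qed.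

Lemma K0_rank_class (M : lmodType R) : fgproj M -> K0_rank (K0_class M) = hsrank M.
Proof.
move=> fgM; have [||c [f [bf cE]]] := @groth_classP R (@fgproj R) _ _ M fgM.
- by move=> N [].
- exact: fgproj_iso.
rewrite /K0_class cE K0_rank_linear.2; apply: (hsrank_iso bf).
exact: groth_mod_prop.
Qed.
End K0Class.

Definition G0_module (k : comNzRingType) (H : algType k) (V : lmodType H) : Prop :=
  fin_gen V /\ fgproj (restr V).

Lemma G0_char_linear (k : comNzRingType) (H : algType k) : linear (@G0_char k H) /\
  forall c : groth_gen (@G0_module k H),
    G0_char (presgen (@ses_rel H (@G0_module k H)) c) = character (groth_mod c).
Proof.
apply: groth_lift_linear => M1 M2 M3 i p [_ fg1] _ [_ fg3] iI pS ip.
exact: (character_short_exact fg1 fg3 (And3 iI pS ip)).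
Qed.

(** * Exactness of the diagonal tensor product *)

Section TensorMaps.
Variable k : comNzRingType.

Lemma tmap_linearP (M N M' N' : lmodType k)
    (f : {linear M -> M'}) (g : {linear N -> N'}) :
  linear (tmap f g) /\ forall m n, tmap f g (tens m n) = tens (f m) (g n).
Proof.
apply: tlift_linear; split=> [n c x y|m c x y].
  by rewrite linearP tensDl tensZl.
by rewrite linearP tensDr tensZr.
Qed.

Lemma tmap_linear (M N M' N' : lmodType k) (f : {linear M -> M'}) (g : {linear N -> N'}) :
  linear (tmap f g).
Proof. exact: (tmap_linearP f g).1. Qed.

Lemma tmapE (M N M' N' : lmodType k) (f : {linear M -> M'}) (g : {linear N -> N'}) m n :
  tmap f g (tens m n) = tens (f m) (g n).
Proof. exact: (tmap_linearP f g).2. Qed.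

Lemma tmap_comp (M N M' N' M'' N'' : lmodType k) (f : {linear M' -> M''})
    (g : {linear N' -> N''}) (f' : {linear M -> M'}) (g' : {linear N -> N'}) t :
  tmap f g (tmap f' g' t) = tmap (f \o f') (g \o g') t.
Proof.
move: t; apply: linear_eq_tens => [c x y||m n].
- by rewrite (tmap_linear f' g') (tmap_linear f g).
- exact: tmap_linear.
- by rewrite (tmapE f' g') (tmapE f g) (tmapE (f \o f') (g \o g')).
Qed.

Lemma tmap_id (M N : lmodType k) (f : M -> M) (g : N -> N) :
  f =1 id -> g =1 id -> tmap f g =1 id.
Proof.
move=> /funext-> /funext->.
apply: linear_eq_tens => //; first exact: (tmap_linear idfun idfun).
exact: (tmapE idfun idfun).
Qed.

Section Splitting.
Variables (M1 M2 M3 N : lmodType k) (i : {linear M1 -> M2}) (p : {linear M2 -> M3})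
  (q : {linear M2 -> M1}) (s : {linear M3 -> M2}).
Hypothesis qs : splitting i p q s.

Lemma tmap_splittingl :
  splitting (@tmap k M1 N M2 N i idfun) (@tmap k M2 N M3 N p idfun)
    (@tmap k M2 N M1 N q idfun) (@tmap k M3 N M2 N s idfun).
Proof.
have [iK sK split1] := qs.
split=> [t|t|]; try by rewrite tmap_comp tmap_id.
apply: linear_eq_tens => // [c x y|m n].
  by rewrite !(tmap_linear, tmap_comp) scalerDr addrACA.
by rewrite !tmap_comp !tmapE -tensDl split1.
Qed.

Lemma tmap_splittingr :
  splitting (@tmap k N M1 N M2 idfun i) (@tmap k N M2 N M3 idfun p)
    (@tmap k N M2 N M1 idfun q) (@tmap k N M3 N M2 idfun s).
Proof.
have [iK sK split1] := qs.
split=> [t|t|]; try by rewrite tmap_comp tmap_id.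
apply: linear_eq_tens => // [c x y|m n].
  by rewrite !(tmap_linear, tmap_comp) scalerDr addrACA.
by rewrite !tmap_comp !tmapE -tensDr split1.
Qed.
End Splitting.
End TensorMaps.

Section DiagonalFunctor.
Variables (k : comNzRingType) (H : hopfAlgType k) (B : comodAlgType H).

Lemma fgproj_diag (M : lmodType B) (V : lmodType H) :
  fgproj M -> fgproj (restr V) -> fgproj (diag_tensor M V).
Proof.
move=> /fgproj_dual_bases[s sP] /fgproj_dual_bases[t tP].
exact: dual_bases_fgproj (diag_dual_basesP sP tP).
Qed.

Definition diag_map (M M' : lmodType B) (V V' : lmodType H)
    (f : {linear M -> M'}) (g : {linear V -> V'}) :
    diag_tensor M V -> diag_tensor M' V' :=
  tmap (restr_fun f) (restr_fun g).

Lemma diag_map_linear (M M' : lmodType B) (V V' : lmodType H)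
  (f : {linear M -> M'}) (g : {linear V -> V'}) : linear (diag_map f g).
Proof.
have dl : linear (diag_map f g : tensor (restr M) (restr V) ->
    tensor (restr M') (restr V')) := tmap_linear (restr_fun f) (restr_fun g).
have dD : {morph diag_map f g : x y / x + y} by exact: (linearD (lin_of dl)).
have d0 : diag_map f g 0 = 0 by exact: (linear0 (lin_of dl)).
move=> b x y; rewrite dD; congr (_ + _).
elim/tensor_ind: x {y} => [|m v x IH]; first by rewrite d0 !scaler0 d0.
rewrite [b *: _]scalerDr !dD IH scalerDr; congr (_ + _).
rewrite -/(diag_tens m v) diag_scaleE (linfun_sum _ _ dl).
have dE (m' : restr M) (v' : restr V) :
    diag_map f g (tens m' v') = tens (restr_fun f m') (restr_fun g v').
  exact: tmapE.
rewrite [diag_map f g (diag_tens m v)]dE [RHS]diag_scaleE.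
apply: eq_bigr => r _; rewrite dE.
by congr tens; apply: linearZ_LR.
Qed.

Lemma diag_short_exactl (M1 M2 M3 : lmodType B) (V : lmodType H)
    (i : {linear M1 -> M2}) (p : {linear M2 -> M3}) :
    projective M3 -> short_exact i p ->
  short_exact (lin_of (diag_map_linear i (idfun : {linear V -> V})))
              (lin_of (diag_map_linear p (idfun : {linear V -> V}))).
Proof.
move=> pr3 ip; have [q [s qs]] := short_exact_splitting pr3 ip.
have qs' : splitting (restr_fun i) (restr_fun p) (restr_fun q) (restr_fun s) := qs.
have sp := @tmap_splittingl k _ _ _ (restr V) _ _ _ _ qs'.
refine (@splitting_short_exact B (diag_tensor M1 V) (diag_tensor M2 V)
  (diag_tensor M3 V) (lin_of (diag_map_linear i idfun))
  (lin_of (diag_map_linear p idfun)) (tmap (restr_fun q) idfun)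
  (tmap (restr_fun s) idfun) _ _ sp).
  exact: (linear0 (lin_of (tmap_linear (restr_fun q) idfun))).
exact: (linear0 (lin_of (tmap_linear (restr_fun s) idfun))).
Qed.

(** The sequence of the Vi need not split over H; a splitting over k is
    enough, since exactness only concerns the underlying k-modules. *)
Lemma diag_short_exactr (M : lmodType B) (V1 V2 V3 : lmodType H)
    (i : {linear V1 -> V2}) (p : {linear V2 -> V3}) :
    projective (restr V3) -> short_exact i p ->
  short_exact (lin_of (diag_map_linear (idfun : {linear M -> M}) i))
              (lin_of (diag_map_linear (idfun : {linear M -> M}) p)).
Proof.
move=> pr3 ip.
have [q [s qs]] := short_exact_splitting (i := restr_fun i) (p := restr_fun p) pr3 ip.
have sp := @tmap_splittingr k _ _ _ (restr M) _ _ _ _ qs.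
refine (@splitting_short_exact B (diag_tensor M V1) (diag_tensor M V2)
  (diag_tensor M V3) (lin_of (diag_map_linear idfun i))
  (lin_of (diag_map_linear idfun p)) (tmap idfun q) (tmap idfun s) _ _ sp).
  exact: (linear0 (lin_of (tmap_linear idfun q))).
exact: (linear0 (lin_of (tmap_linear idfun s))).
Qed.

Lemma K0_class_diagl (M1 M2 M3 : lmodType B) (V : lmodType H)
    (i : {linear M1 -> M2}) (p : {linear M2 -> M3}) :
    fgproj M1 -> fgproj M2 -> fgproj M3 -> fgproj (restr V) -> short_exact i p ->
  K0_class (diag_tensor M2 V) =
    K0_class (diag_tensor M1 V) + K0_class (diag_tensor M3 V).
Proof.
move=> fg1 fg2 fg3 fgV ip.
by apply: K0_class_short_exact (diag_short_exactl V fg3.2 ip); apply: fgproj_diag.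
Qed.

Lemma K0_class_diagr (M : lmodType B) (V1 V2 V3 : lmodType H)
    (i : {linear V1 -> V2}) (p : {linear V2 -> V3}) :
    fgproj M -> fgproj (restr V1) -> fgproj (restr V2) -> fgproj (restr V3) ->
    short_exact i p ->
  K0_class (diag_tensor M V2) =
    K0_class (diag_tensor M V1) + K0_class (diag_tensor M V3).
Proof.
move=> fgM fg1 fg2 fg3 ip.
by apply: K0_class_short_exact (diag_short_exactr M fg3.2 ip); apply: fgproj_diag.
Qed.

(** * Action of G_0(H) on K_0(B) *)

Definition class_act (M : lmodType B) : G0 H -> K0 B :=
  groth_lift (fun V => K0_class (diag_tensor M V)).

Lemma class_act_linear (M : lmodType B) : fgproj M -> linear (class_act M) /\
  forall c : groth_gen (@G0_module k H),
    class_act M (presgen (@ses_rel H (@G0_module k H)) c) =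
      K0_class (diag_tensor M (groth_mod c)).
Proof.
move=> fgM; apply: groth_lift_linear => V1 V2 V3 i p [_ fg1] [_ fg2] [_ fg3] iI pS ip.
exact: K0_class_diagr (And3 iI pS ip).
Qed.

(** Additivity in M, for an arbitrary y: the two sides of the relation are
    additive in y, which reduces it to y = [V]. *)
Lemma K0_act_gen_linear (y : G0 H) :
  linear (groth_lift (fun M => class_act M y) : K0 B -> K0 B) /\
  forall c : groth_gen (@fgproj B),
    groth_lift (fun M => class_act M y) (presgen (@ses_rel B (@fgproj B)) c) =
      class_act (groth_mod c) y.
Proof.
apply: groth_lift_linear => M1 M2 M3 i p fg1 fg2 fg3 iI pS ip.
have [l1 E1] := class_act_linear fg1; have [l2 E2] := class_act_linear fg2.
have [l3 E3] := class_act_linear fg3.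
move: y; apply: groth_ext l2 _ _ => [c x y|c].
  by rewrite l1 l3 scalerDr addrACA.
rewrite E1 E2 E3; apply: K0_class_diagl (And3 iI pS ip) => //.
by have [] := groth_mod_prop c.
Qed.

(** The underlying operation has to be shown bilinear before its value on
    pure tensors is known, since K0_act reads it off a representative. *)
Lemma K0_act_bilinear : @bilinear_map int (K0 B) (G0 H) (K0 B)
  (fun x y => groth_lift (fun M => class_act M y) x).
Proof.
split=> [y|x c y z]; first exact: (K0_act_gen_linear y).1.
move: x; apply: groth_ext => [|n u v|d].
- exact: (K0_act_gen_linear _).1.
- rewrite !(K0_act_gen_linear _).1 !scalerDr !scalerA [c * n]mulrC.
  by rewrite addrACA.
- rewrite !(K0_act_gen_linear _).2.
  exact: (class_act_linear (groth_mod_prop d)).1.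
Qed.

Lemma K0_act_linear : linear (@K0_act k H B).
Proof. exact: (tlift_linear K0_act_bilinear).1. Qed.

Lemma K0_act_tens (c : groth_gen (@fgproj B)) (d : groth_gen (@G0_module k H)) :
  K0_act (tens (presgen (@ses_rel B (@fgproj B)) c : K0 B)
               (presgen (@ses_rel H (@G0_module k H)) d : G0 H)) =
  K0_class (diag_tensor (groth_mod c) (groth_mod d)).
Proof.
rewrite [LHS](tlift_linear K0_act_bilinear).2 (K0_act_gen_linear _).2.
exact: (class_act_linear (groth_mod_prop c)).2.
Qed.

Lemma tr_act_map_linear : linear (@tr_act_map k H B) /\
  forall (x : hstrace B) (f : zmodule (trform H)), tr_act_map (tens x f) = tr_act x f.
Proof. exact: tlift_linear (@tr_act_bilinear k H B). Qed.
End DiagonalFunctor.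

Theorem lemma7 (k : comNzRingType) (H : hopfAlgType k) (B : comodAlgType H) :
  (forall (M : lmodType B) (V : lmodType H),
      fgproj M -> fin_gen V -> fgproj (restr V) ->
    hsrank (diag_tensor M V) = tr_act (hsrank M) (character V)) /\
  K0_rank (R := B) \o K0_act (H := H) (B := B) =1
    tr_act_map (H := H) (B := B) \o tmap (K0_rank (R := B)) (G0_char (H := H)).
Proof.
have rank_diag (M : lmodType B) (V : lmodType H) : fgproj M -> fgproj (restr V) ->
    hsrank (diag_tensor M V) = tr_act (hsrank M) (character V).
  move=> /fgproj_dual_bases[s sP] /fgproj_dual_bases[t tP].
  exact: hsrank_diag_tensor sP tP.
split=> [M V fgM _ fgV|]; first exact: rank_diag.
have [rl rE] := K0_rank_linear B; have [cl cE] := G0_char_linear H.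
have [al aE] := tr_act_map_linear B.
have ml := tmap_linear (lin_of rl) (lin_of cl).
have ll := comp_linear (@K0_act_linear k H B) rl.
apply: (linear_eq_tens ll (comp_linear ml al)) => x y /=.
rewrite [tmap _ _ _](tmapE (lin_of rl) (lin_of cl)) aE /=.
move: y; apply: groth_ext => [||d].
- exact: (comp_linear ((tens_bilinear _ _).2 x) ll).
- exact: (comp_linear cl ((tr_act_bilinear B).2 _)).
move: x; apply: groth_ext => [||c].
- exact: (comp_linear ((tens_bilinear _ _).1 _) ll).
- exact: (comp_linear rl ((tr_act_bilinear B).1 _)).
have fgc := groth_mod_prop c; have [_ fgd] := groth_mod_prop d.
rewrite K0_act_tens rE cE K0_rank_class ?rank_diag//.
exact: fgproj_diag.
Qed.
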